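(* For every real $z\in(0,\infty)\setminus(z_c^-,z_c^+)$, almost surely $\lim_{t\to\infty}M(t,z)=0$ and $\lim_{n\to\infty}\mathcal{M}_n(z)=0$.
   Context: Let $\mathbb{U}=\{\emptyset\}\cup\bigcup_{n\ge1}\{0,1\}^n$ be the set of finite words on $\{0,1\}$; $|u|$ denotes the length (depth) of $u$. A complete binary tree is a finite subset $T\subset\mathbb{U}$ such that $\emptyset\in T$; $uv\in T\Rightarrow u\in T$; $u1\in T\Leftrightarrow u0\in T$. Its leaves, forming the set $\partial T$, are the nodes of $T$ with no strict descendants in $T$. Yule tree process $(\mathbb{T}_t)_{t\ge0}$: $\mathbb{T}_0=\{\emptyset\}$; each leaf $u$ carries an independent exponential clock of parameter 1, and when it rings $u$ becomes an internal node and two new leaves $u0,u1$ (with fresh independent clocks) are added. Let $N_t=\#\partial\mathbb{T}_t$ and $\tau_n=\inf\{t: N_t=n+1\}$ ($\tau_0=0$). The binary search tree (BST) process is constructed on the same probability space by $\mathcal{T}_n:=\mathbb{T}_{\tau_n}$, $n\ge0$; it is a Markov chain started at $\{\emptyset\}$ in which a uniformly chosen leaf $u$ among the $n+1$ leaves of $\mathcal{T}_n$ is replaced by an internal node with two leaf children $u0,u1$. Martingales: $M(t,z):=\sum_{u\in\partial\mathbb{T}_t}z^{|u|}e^{t(1-2z)}$ and $\mathcal{M}_n(z):=\frac1{C_n(z)}\sum_{u\in\partial\mathcal{T}_n}z^{|u|}$ with $C_0(z)=1$, $C_n(z)=\prod_{k=0}^{n-1}\frac{k+2z}{k+1}$.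 Let $\eta_2(x)=x\log\frac x2-x+2$, $x\ge0$; $c'<c$ are the two solutions of $\eta_2(x)=1$ ($c'=0.3733\ldots$, $c=4.31107\ldots$), and $z_c^-=c'/2$, $z_c^+=c/2$. *)

(* Defs.v *)
From HB Require Import structures.
From mathcomp Require Import all_boot all_order all_algebra.
From mathcomp Require Import all_classical all_reals all_analysis.
Set Implicit Arguments.
Unset Strict Implicit.
Unset Printing Implicit Defensive.
Import Order.TTheory GRing.Theory Num.Theory.
Import numFieldNormedType.Exports.
Local Open Scope classical_set_scope.
Local Open Scope ring_scope.

(* [:: b1; ...; bn] stands for the word b1...bn (false = 0, true = 1), [::] for
   the root, u ++ v for the concatenation uv and size u for the depth |u|. *)
Definition word := seq bool.

Definition leaves (T : set word) : set word :=
  [set u | T u /\ forall v : word, v != [::] -> ~ T (u ++ v)].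

Definition mutually_independent (I : eqType) d (Omega : measurableType d)
    (R : realType) (P : probability Omega R) (X : I -> {RV P >-> R}) : Prop :=
  forall (s : seq I) (B : I -> set R),
    uniq s -> (forall i, measurable (B i)) ->
    P (\bigcap_(i in [set` s]) (X i @^-1` B i)) =
    (\prod_(i <- s) P (X i @^-1` B i))%E.

Definition iid_exponential1_clocks d (Omega : measurableType d)
    (R : realType) (P : probability Omega R)
    (clock : word -> {RV P >-> R}) : Prop :=
  mutually_independent clock /\
  forall (u : word) (B : set R), measurable B ->
    distribution P (clock u) B = exponential_prob 1 B.

Section trees.
Context (R : realType).

(* A realization e of the clocks: e u is the time that u spends as a leaf
   before splitting. *)
Implicit Types (e : word -> R).

(* u appears when the last of its strict prefixes take k u (k < |u|) splits. *)
Definition birth e (u : word) : R := \sum_(k < size u) e (take k u).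

Definition yule_tree e (t : R) : set word := [set u | birth e u <= t].

(* card_eq with 'I_n.+1 forces the set of leaves to be finite. Almost surely
   the set of times below is nonempty and its infimum is attained. *)
Definition tau e (n : nat) : R :=
  inf [set t | 0 <= t /\ (leaves (yule_tree e t) #= `I_n.+1)%card].

Definition bst e (n : nat) : set word := yule_tree e (tau e n).

(* The number of leaves is only almost surely finite, hence the sums of
   nonnegative terms (z >= 0) in \bar R, which have no default value. *)
Definition yule_martingale e (t z : R) : \bar R :=
  \esum_(u in leaves (yule_tree e t))
    (z ^+ size u * expR (t * (1 - 2 * z)))%:E.

Definition C (n : nat) (z : R) : R :=
  \prod_(k < n) ((k%:R + 2 * z) / k.+1%:R).

Definition bst_martingale e (n : nat) (z : R) : \bar R :=
  ((C n z)^-1%:E * \esum_(u in leaves (bst e n)) (z ^+ size u)%:E)%E.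

(* ln 0 = 0 in the library, so that eta2 0 = 2, as it should be. *)
Definition eta2 (x : R) : R := x * ln (x / 2) - x + 2.

End trees.

(* Main.v *)
Require Import Defs.
From HB Require Import structures.
From mathcomp Require Import finmap.
From mathcomp Require Import all_boot all_order all_algebra.
From mathcomp Require Import all_classical all_reals all_analysis.
From mathcomp Require Import measurable_realfun ring lra.
Import Order.TTheory GRing.Theory Num.Theory.
Import numFieldNormedType.Exports.
Local Open Scope classical_set_scope.
Local Open Scope ring_scope.
Set Implicit Arguments.
Unset Strict Implicit.
Unset Printing Implicit Defensive.

(** Both limits come from one property of the nonnegative martingale
    [M(t, z)]: it tends to 0 when [eta2 (2 z) >= 1], that is, when
    [2 z - 1 <= 2 z ln z].  Since [eta2] is convex and equals 1 at [c'] and [c],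
    this inequality holds exactly outside the open critical interval
    ([outside_critical_interval]).

    Why the martingale degenerates.  Attach to each generation [k] the mass
    [Y_k], the sum over the words [u] of length [k] of the products of
    [A = z e^{(1 - 2 z) r}] over the splitting delays [r] of the strict prefixes
    of [u].  Then [E Y_k = 1] and
    [Y_{k+1} = A (Y_k' + Y_k'')] with independent factors.  The inequality on
    [z] makes [2 E A^{1-d} <= 1 + O(d^2)] for small [d > 0]
    ([branch_moment_ub]), whereas [x^{1-d} + y^{1-d}] exceeds
    [(x + y)^{1-d}] by at least a constant times [d] as long as [x] and [y] stay
    in a compact subset of the open half-line ([powR_deficit]).  If [Y_k] stayed
    in such a compact set with probability at least [p] for all [k], the moment
    [E Y_k^{1-d}] would lose a fixed amount at each generation, which is
    impossible ([moderate_vanishes]).  So there are generations at which [Y_k]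
    is small with probability close to 1.  Given the first generations, the
    conditional mean of [M(t, z)] is about [Y_k], and by Jensen's inequality the
    Laplace transform of [M(t, z)] dominates that of [Y_k] up to an error
    [5^k e^{-t/2}] ([laplace_comparison]): [M(t, z)] tends to 0 in probability.
    A maximal inequality started at a late integer time turns this into almost
    sure convergence along the integers ([exceeds_vanish]), and the monotonicity
    of [t |-> \sum_u z^|u|] fills in the real times ([additive_small]).

    From the Yule tree to the binary search tree.  One has
    [M_n(z) = M(tau_n, z) e^{(2 z - 1) tau_n} / C_n(z)], and [C_n(z)] is at least
    a constant times [(n + 1)^{2 z - 1}] ([C_lower]).  It remains to know that
    [tau_n - ln (n + 1)] is bounded ([tau_ln]), i.e. that [N_t e^{-t}] is almost
    surely bounded and bounded away from 0.  Both bounds are maximal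
    inequalities, for the supermartingales [N_t e^{-t}] and
    [(1 + l e^{-t})^{-N_t}].

    All expectations are computed on the finitely many clocks of the words of
    length less than [n].  Their law is defined by recursion on [n] (the clock
    of the root and two independent copies of the same array), so that the
    supermartingale property is an induction on [n] that conditions on the first
    splitting time; neither filtrations nor conditional expectations appear. *)

(** * Densities, product probabilities and the exponential law *)

Section density.
Local Open Scope ereal_scope.
Context d (T : measurableType d) (R : realType).
Variables (mu nu : {measure set T -> \bar R}) (p : T -> R).
Hypotheses (mp : measurable_fun setT p) (p0 : forall x, (0 <= p x)%R).
Hypothesis nuE : forall A, measurable A -> nu A = \int[mu]_(x in A) (p x)%:E.

Import HBNNSimple.

Lemma integral_nnsfun_density (g : {nnsfun T >-> R}) :
  \int[nu]_x (g x)%:E = \int[mu]_x ((g x)%:E * (p x)%:E).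
Proof.
have mpE : measurable_fun setT (fun x => (p x)%:E) by exact/measurable_EFinP.
under eq_integral do rewrite fimfunE -fsumEFin//.
rewrite ge0_integral_fsum//; last 2 first.
  - by move=> r; exact/measurable_EFinP/measurableT_comp.
  - by move=> n x _; rewrite EFinM nnfun_muleindic_ge0.
under [RHS]eq_integral.
  move=> x xD; rewrite fimfunE -fsumEFin// ge0_mule_fsuml; last first.
    by move=> r; rewrite EFinM nnfun_muleindic_ge0.
  over.
rewrite [RHS]ge0_integral_fsum//; last 2 first.
  - move=> r; apply: emeasurable_funM => //.
    exact/measurable_EFinP/measurableT_comp.
  - by move=> n x _; rewrite mule_ge0 ?lee_fin// -lee_fin EFinM nnfun_muleindic_ge0.
apply: eq_fsbigr => r _.
rewrite integralZl_indic_nnsfun// integral_indic// setIT nuE//.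
have [r0|r0] := leP 0%R r; last first.
  rewrite preimage_nnfun0//.
  rewrite integral_set0 mule0 integral0_eq// => x _.
  by rewrite indicE in_set0 mulr0 mul0e.
rewrite -ge0_integralZl//; last 2 first.
  - exact: measurable_funTS.
  - by move=> x _; rewrite lee_fin.
rewrite integral_mkcond; apply: eq_integral => x _.
rewrite patchE indicE; case: ifPn => _; first by rewrite mulr1.
by rewrite mulr0 mul0e.
Qed.

(** Monotone approximation by simple functions reduces the claim to
    indicators, where it is the hypothesis on [nu]. *)
Lemma ge0_integral_density (f : T -> \bar R) :
  measurable_fun setT f -> (forall x, 0 <= f x) ->
  \int[nu]_x f x = \int[mu]_x (f x * (p x)%:E).
Proof.
move=> mf f0.
have mpE : measurable_fun setT (fun x => (p x)%:E) by exact/measurable_EFinP.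
pose f_ := nnsfun_approx measurableT mf.
transitivity (lim (\int[nu]_x (f_ n x)%:E @[n --> \oo])%E).
  rewrite -monotone_convergence//=.
  - apply: eq_integral => ? /[!inE] xD; apply/esym/cvg_lim => //=.
    exact: cvg_nnsfun_approx.
  - by move=> n; exact/measurable_EFinP/measurable_funTS.
  - by move=> n ? _; rewrite lee_fin.
  - by move=> ? _ ? ? mn; rewrite lee_fin; exact/lefP/nd_nnsfun_approx.
rewrite (_ : (fun n => \int[nu]_x (f_ n x)%:E) =
   (fun n => \int[mu]_x ((f_ n x)%:E * (p x)%:E))); last first.
  by apply/funext => n; exact: integral_nnsfun_density.
rewrite -monotone_convergence//=.
- apply: eq_integral => x _; apply/cvg_lim => //.
  apply: cvgeMr => //.
  by apply: cvg_nnsfun_approx => //.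
- by move=> n; apply: emeasurable_funM => //; exact/measurable_EFinP.
- by move=> n x _; rewrite mule_ge0 ?lee_fin.
- move=> x _ m n mn; rewrite lee_wpmul2r// ?lee_fin//; exact/lefP/nd_nnsfun_approx.
Qed.
End density.

Section product_probability.
Context d1 d2 (T1 : measurableType d1) (T2 : measurableType d2) (R : realType).
Variables (P1 : probability T1 R) (P2 : probability T2 R).

Let prodT : (P1 \x P2)%E [set: T1 * T2] = 1%E.
Proof.
transitivity (P1 setT * P2 setT)%E; first by rewrite -setXTT product_measure1E.
by rewrite !probability_setT mule1.
Qed.

Let prod_measure := (P1 \x P2)%E.
HB.instance Definition _ := Measure.on prod_measure.
HB.instance Definition _ := @Measure_isProbability.Build _ _ R prod_measure prodT.

(** The product measure as an element of [probability], the type in which the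
    law of an array of clocks is defined by recursion. *)
Definition prod_prob : probability (T1 * T2)%type R := prod_measure.

Lemma prod_probE A B : measurable A -> measurable B ->
  prod_prob (A `*` B) = (P1 A * P2 B)%E.
Proof. exact: product_measure1E. Qed.

Lemma prod_prob_integral (f : T1 * T2 -> \bar R) :
  measurable_fun setT f -> (forall p, 0 <= f p)%E ->
  (\int[prod_prob]_p f p = \int[P1]_x \int[P2]_y f (x, y))%E.
Proof. by move=> mf f0; exact: fubini_tonelli1. Qed.

Lemma prod_prob_integral_sym (f : T1 * T2 -> \bar R) :
  measurable_fun setT f -> (forall p, 0 <= f p)%E ->
  (\int[prod_prob]_p f p = \int[P2]_y \int[P1]_x f (x, y))%E.
Proof. by move=> mf f0; exact: fubini_tonelli2. Qed.
End product_probability.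
Arguments prod_prob : simpl never.

Lemma measurable_fun_EFin d (T : measurableType d) (R : realType) (D : set T)
    (f : T -> R) :
  measurable_fun D f -> measurable_fun D (fun x => (f x)%:E).
Proof. by move=> mf; exact/measurable_EFinP. Qed.

Section exp_law.
Variable R : realType.
Let Rm : measurableType default_measure_display := R.

Lemma measurable_idR : measurable_fun setT (idfun : measurableTypeR R -> Rm).
Proof. by move=> _ A mA; rewrite setTI. Qed.

Definition idR : {mfun measurableTypeR R >-> Rm} :=
  HB.pack (idfun : measurableTypeR R -> Rm) (isMeasurableFun.Build _ _ _ _ _ measurable_idR).

Definition exp_prob1 : probability (measurableTypeR R) R.
Proof. by refine (exponential_prob (1 : R)). Defined.

(** [exponential_prob] lives on the copy [measurableTypeR R] of the measurable
    space [R]; the image under the identity moves it to the structure carried by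
    the random variables of the statement. *)
Definition exp_law : probability Rm R := distribution exp_prob1 idR.

Lemma exp_lawE B : exp_law B = exponential_prob 1 B.
Proof. by []. Qed.

Local Open Scope ereal_scope.
Notation leb := (@lebesgue_measure R).

Lemma ge0_integral_exp_law (E : set R) (f : R -> \bar R) :
  measurable E -> measurable_fun setT f -> (forall x, 0 <= f x) ->
  \int[exp_law]_(x in E) f x =
  \int[leb]_(x in E `&` `[0%R, +oo[) (f x * (expR (- x))%:E).
Proof.
move=> mE mf f0.
rewrite [LHS]integral_mkcond [RHS]integral_mkcond.
have mfE : measurable_fun setT (f \_ E).
  by apply/(measurable_restrictT _ mE); exact: measurable_funTS.
have fE0 x : 0 <= (f \_ E) x by rewrite patchE; case: ifP.
rewrite ge0_integral_pushforward//=; last first.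
  exact: measurable_idR.
rewrite preimage_setT.
rewrite (@ge0_integral_density _ (measurableTypeR R) R leb exp_prob1 (exponential_pdf 1)) //=.
- apply: eq_integral => x _; rewrite !patchE /= /exponential_pdf patchE.
  rewrite in_setI; case: (x \in E) => /=; last by rewrite mul0e.
  by case: ifP => _; rewrite ?mule0// mul1r mulN1r.
- exact: measurable_exponential_pdf.
- by move=> x; apply: exponential_pdf_ge0.
Qed.

Local Close Scope ereal_scope.
Lemma continuous_expRM (c : R) : continuous (fun x : R => expR (c * x)).
Proof.
move=> x; apply: (@continuous_comp _ _ _ ( *%R c) expR).
  exact: mulrl_continuous.
exact: continuous_expR.
Qed.

Lemma integral_expR_tail (c t : R) : 0 < c ->
  (\int[leb]_(x in `[t, +oo[) (expR (- c * x))%:E = (expR (- c * t) / c)%:E)%E.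
Proof.
move=> c0.
have dF (x : R) : is_derive x 1 (fun x : R => - c^-1 * expR (- c * x)) (expR (- c * x)).
  apply: is_derive_eq.
  rewrite /GRing.scale /=. by field; rewrite gt_eqF.
have cF : continuous (fun x : R => - c^-1 * expR (- c * x)).
  move=> x; apply: (@continuous_comp _ _ _ (fun x => expR (- c * x)) ( *%R (- c^-1))).
    exact: continuous_expRM.
  exact: mulrl_continuous.
rewrite (@ge0_continuous_FTC2y _ _ (fun x => - c^-1 * expR (- c * x)) _ 0).
- by rewrite sub0e -EFinN mulNr opprK mulrC.
- by move=> x _; exact: expR_ge0.
- apply: continuous_subspaceT => x; exact: continuous_expRM.
- rewrite -(mulr0 (- c^-1)); apply: cvgMr.
  rewrite (_ : (fun x => expR (- c * x)) =
               (fun z => expR (- z)) \o (fun z => c * z)); last first.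
    by apply: eq_fun => x; rewrite mulNr.
  apply: (@cvg_comp _ _ _ _ _ _ (pinfty_nbhs R)); last exact: cvgr_expR.
  exact: gt0_cvgMry.
- by move=> x _; case: (dF x).
- by apply: cvg_at_right_filter; exact: cF.
- by move=> x _; rewrite derive1E; case: (dF x).
Qed.

Lemma integral_exp_law_expR (b : R) : -1 < b ->
  (\int[exp_law]_r (expR (- b * r))%:E = (1 + b)^-1%:E)%E.
Proof.
move=> b1.
rewrite ge0_integral_exp_law//=; last first.
  by apply: measurable_fun_EFin; apply: continuous_measurable_fun; exact: continuous_expRM.
rewrite setTI.
have E (x : R) : ((expR (- b * x))%:E * (expR (- x))%:E = (expR (- (1 + b) * x))%:E)%E.
  by rewrite -EFinM -expRD; congr (expR _)%:E; ring.
under eq_integral do rewrite E.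
by rewrite integral_expR_tail ?mulr0 ?expR0 ?mul1r//; lra.
Qed.

Lemma exp_law_itvy (t : R) : 0 <= t -> exp_law `]t, +oo[%classic = (expR (- t))%:E.
Proof.
move=> t0.
transitivity (\int[exp_law]_(x in `]t, +oo[) (cst 1%E x))%E.
  by rewrite integral_cst//= mul1e.
rewrite ge0_integral_exp_law//=.
rewrite setIidl; last first.
  by apply: subset_itvr; rewrite bnd_simp.
under eq_integral do rewrite mul1e -mulN1r.
rewrite integral_itv_obnd_cbnd.
  by rewrite integral_expR_tail// divr1 mulN1r.
by apply: measurable_fun_EFin; apply: measurable_funTS; apply: continuous_measurable_fun; exact: continuous_expRM.
Qed.

Lemma exp_law_set1 (c : R) : exp_law [set c] = 0%E.
Proof.
apply/eqP; rewrite eq_le measure_ge0 andbT.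
rewrite exp_lawE /exponential_prob.
by rewrite integral_set1.
Qed.

Lemma exp_law_le0 : exp_law `]-oo, 0]%classic = 0%E.
Proof.
have := @probability_setC _ _ _ exp_law `]0, +oo[%classic (measurable_itv _).
rewrite setCitvr exp_law_itvy// oppr0 expR0 subee//.
Qed.

(** The primitive is taken against the density [e^{-x}], so that balance
    equations for leaf weights become derivatives of [y (h + x) e^{-x}]. *)
Lemma integral_exp_law_FTC (f k : R -> R) (s t : R) : 0 <= s -> s <= t ->
  (forall x, 0 <= f x) -> continuous f ->
  (forall x : R, is_derive x 1 k (- (expR (- x) * f x))) ->
  (\int[exp_law]_(x in `]s, t]) (f x)%:E = (k s - k t)%:E)%E.
Proof.
move=> s0; rewrite le_eqVlt => /predU1P[<- _ _ _|st f0 cf dk].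
  by rewrite set_itv_ge ?bnd_simp ?ltxx// integral_set0 subrr.
rewrite ge0_integral_exp_law//=; last first.
  by apply: measurable_fun_EFin; exact: continuous_measurable_fun.
rewrite setIidl; last first.
  by move=> x /=; rewrite !in_itv/= andbT => /andP[/ltW sx _]; exact: le_trans sx.
under eq_integral do rewrite -EFinM.
have cg : continuous (fun x => f x * expR (- x)).
  move=> x; apply: cvgM; first exact: cf.
  apply: (@continuous_comp _ _ _ -%R expR); first exact: opp_continuous.
  exact: continuous_expR.
rewrite integral_itv_obnd_cbnd; last first.
  by apply: measurable_fun_EFin; apply: measurable_funTS; exact: continuous_measurable_fun.
rewrite (@continuous_FTC2 _ _ (fun x => - k x))//.
- by rewrite -EFinB opprK addrC.
- by apply: continuous_subspaceT => x; exact: cg.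
- have ck : continuous k by move=> x; apply/differentiable_continuous/derivable1_diffP; case: (dk x).
  split.
  + by move=> x _; apply: derivableN; case: (dk x).
  + by apply: cvg_at_right_filter; apply: cvgN; exact: ck.
  + by apply: cvg_at_left_filter; apply: cvgN; exact: ck.
- move=> x _; rewrite derive1E deriveN; last by case: (dk x).
  by case: (dk x) => _ ->; rewrite opprK mulrC.
Qed.

End exp_law.
Arguments exp_law : simpl never.

(** * The law of the clocks of the words of bounded length *)

Fixpoint short_words (n : nat) : seq word :=
  if n is n'.+1 then
    [::] :: map (cons false) (short_words n') ++ map (cons true) (short_words n')
  else [::].

Lemma mem_short_words n u : (u \in short_words n) = (size u < n)%N.
Proof.
elim: n u => [//|n IH] [|b u]; first by rewrite inE eqxx.
rewrite inE /= mem_cat ltnS; apply/orP/idP.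
  by case=> /mapP[v + [_ ->]]; rewrite IH.
move=> un; case: b; [right|left]; apply: map_f; rewrite IH//.
Qed.

Lemma short_words_uniq n : uniq (short_words n).
Proof.
elim: n => [//|n IH] /=; apply/andP; split.
  by rewrite mem_cat; apply/negP => /orP[] /mapP[].
rewrite cat_uniq !map_inj_uniq ?IH ?andbT//=; try by move=> x y [].
by apply/hasPn => _ /mapP[v _ ->]; apply/negP => /mapP[].
Qed.

Section product_generators.
Context d1 d2 (T1 : measurableType d1) (T2 : measurableType d2).
Variables (G1 : set (set T1)) (G2 : set (set T2)).
Hypotheses (G1E : measurable = <<s G1 >>) (G2E : measurable = <<s G2 >>).
Hypotheses (G1T : G1 setT) (G2T : G2 setT).

(** The usual statement for generators of a product sigma-algebra; the
    full sets must be among the generators, since cylinders are built from them. *)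
Lemma measurable_prod_generators :
  (measurable : set (set (T1 * T2))) = <<s [set A `*` B | A in G1 & B in G2] >>.
Proof.
set H := [set A `*` B | A in G1 & B in G2].
have H1 A : measurable A -> <<s H >> (A `*` setT).
  rewrite G1E; apply: (@smallest_sub _ _ _ [set A | <<s H >> (A `*` setT)]).
    split => /=.
    - by rewrite set0X; exact: sigma_algebra0.
    - move=> B HB; rewrite (_ : (setT `\` B) `*` setT = setT `\` (B `*` setT)).
        exact: sigma_algebraCD.
      by apply/seteqP; split=> -[x y] /=; tauto.
    - move=> F HF;
      rewrite (_ : _ `*` _ = \bigcup_k (F k `*` setT)); first exact: sigma_algebra_bigcup.
      by apply/seteqP; split=> [[x y] /= [[k _ Fk] _]|[x y] /= [k _ [Fk _]]];
        [exists k|split => //; exists k].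
  by move=> B GB; apply: sub_sigma_algebra; exists B => //; exists setT.
have H2 A : measurable A -> <<s H >> (setT `*` A).
  rewrite G2E; apply: (@smallest_sub _ _ _ [set A | <<s H >> (setT `*` A)]).
    split => /=.
    - by rewrite setX0; exact: sigma_algebra0.
    - move=> B HB; rewrite (_ : setT `*` (setT `\` B) = setT `\` (setT `*` B)).
        exact: sigma_algebraCD.
      by apply/seteqP; split=> -[x y] /=; tauto.
    - move=> F HF;
      rewrite (_ : _ `*` _ = \bigcup_k (setT `*` F k)); first exact: sigma_algebra_bigcup.
      by apply/seteqP; split=> [[x y] /= [_ [k _ Fk]]|[x y] /= [k _ [_ Fk]]];
        [exists k|split => //; exists k].
  by move=> B GB; apply: sub_sigma_algebra; exists setT => //; exists B.
rewrite measurable_prod_measurableType eqEsubset; split.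
  apply: smallest_sub; first exact: smallest_sigma_algebra.
  move=> _ [A mA] [B mB] <-.
  have -> : A `*` B = (A `*` setT) `&` (setT `*` B) by apply/seteqP; split=> -[x y] /=; tauto.
  by apply: (@measurableI _ (g_sigma_algebraType H)); [exact: H1|exact: H2].
apply: smallest_sub; first exact: smallest_sigma_algebra.
move=> _ [A GA] [B GB] <-; apply: sub_sigma_algebra; exists A; first by rewrite G1E; exact: sub_sigma_algebra.
by exists B => //; rewrite G2E; exact: sub_sigma_algebra.
Qed.
End product_generators.
Section clocks.
Variable R : realType.

Fixpoint clocks_disp (n : nat) : measure_display :=
  if n is n'.+1 then
    measure_prod_display (default_measure_display,
      measure_prod_display (clocks_disp n', clocks_disp n'))
  else default_measure_display.

(** The clocks of the words of length less than [n], arranged as the tree they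
    label: the clock at the root, then the arrays below its two children.  This
    shape makes independence of the two subtrees a product of measures and lets
    every later proof be an induction on [n]. *)
Fixpoint clocks (n : nat) : measurableType (clocks_disp n) :=
  match n return measurableType (clocks_disp n) with
  | 0 => (unit : measurableType _)
  | n'.+1 => (((R : measurableType _) * (clocks n' * clocks n'))%type : measurableType _)
  end.

Fixpoint clocks_law (n : nat) : probability (clocks n) R :=
  match n return probability (clocks n) R with
  | 0 => (dirac tt : probability _ R)
  | n'.+1 => prod_prob (exp_law R) (prod_prob (clocks_law n') (clocks_law n'))
  end.

Definition subclock (e : word -> R) (b : bool) : word -> R := fun u => e (b :: u).

Fixpoint restrict_clocks (n : nat) (e : word -> R) : clocks n :=
  match n return clocks n with
  | 0 => tt
  | n'.+1 => (e [::], (restrict_clocks n' (subclock e false),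
                       restrict_clocks n' (subclock e true)))
  end.

(** Rectangles form the pi-system on which the joint law of independent
    clocks is known. *)
Fixpoint clock_rect (n : nat) (B : word -> set R) : set (clocks n) :=
  match n return set (clocks n) with
  | 0 => setT
  | n'.+1 => B [::] `*` (@clock_rect n' (fun u => B (false :: u)) `*` @clock_rect n' (fun u => B (true :: u)))
  end.
Arguments clock_rect : clear implicits.

Lemma measurable_rect n B : (forall u, measurable (B u)) -> measurable (clock_rect n B).
Proof.
elim: n B => [//|n IH] B mB /=.
by apply: measurableX => //; apply: measurableX; exact: IH.
Qed.

Lemma clocks_law_rect n B : (forall u, measurable (B u)) ->
  clocks_law n (clock_rect n B) = (\prod_(u <- short_words n) exp_law R (B u))%E.
Proof.
elim: n B => [|n IH] B mB.
  by rewrite big_nil probability_setT.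
transitivity (prod_prob (exp_law R) (prod_prob (clocks_law n) (clocks_law n)) (clock_rect n.+1 B)) => //.
rewrite [clock_rect _ _]/= prod_probE//; last first.
  by apply: measurableX; exact: measurable_rect.
rewrite prod_probE//; try exact: measurable_rect.
by rewrite !IH// big_cons big_cat !big_map.
Qed.

Lemma restrict_clocks_rect n e B :
  clock_rect n B (restrict_clocks n e) <-> forall u, (size u < n)%N -> B u (e u).
Proof.
elim: n e B => [|n IH] e B /=; first by split.
split=> [[/= B0 [/IH Bf /IH Bt]] [|[] u]//|H]; [exact: Bt|exact: Bf|].
by split; [exact: H|split; apply/IH => u un; exact: H].
Qed.

Definition clock_rects n : set (set (clocks n)) :=
  [set clock_rect n B | B in [set B | forall u, measurable (B u)]].
Arguments clock_rects : clear implicits.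

Lemma rectsT n : clock_rects n setT.
Proof.
exists (fun _ => setT) => //=.
by elim: n => [//|n IH] /=; rewrite IH !setXTT.
Qed.

Lemma rectI n B C : clock_rect n B `&` clock_rect n C = clock_rect n (fun u => B u `&` C u).
Proof.
elim: n B C => [|n IH] B C /=; first by rewrite setIT.
by rewrite -!setXI !IH.
Qed.

Lemma rects_setI n : setI_closed (clock_rects n).
Proof.
move=> _ _ [B mB <-] [C mC <-]; rewrite rectI.
by exists (fun u => B u `&` C u) => // u; exact: measurableI.
Qed.

Lemma measurable_rects n : measurable = <<s clock_rects n >>.
Proof.
elim: n => [|n IH].
  rewrite eqEsubset; split; last first.
    by apply: smallest_sub; [exact: sigma_algebra_measurable|].
  move=> A _; have [A0|A0] := pselect (A tt).
    rewrite (_ : A = setT); first by apply: sub_sigma_algebra; exact: (rectsT 0).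
    by apply/seteqP; split=> -[].
  rewrite (_ : A = set0); first exact: sigma_algebra0.
  by apply/seteqP; split=> -[].
transitivity <<s [set A `*` B | A in (measurable : set (set R)) &
   B in [set A `*` B | A in clock_rects n & B in clock_rects n]] >>.
  apply: measurable_prod_generators => //.
  - rewrite eqEsubset; split; first exact: sub_sigma_algebra.
    by apply: smallest_sub; [exact: sigma_algebra_measurable|].
  - by apply: measurable_prod_generators => //; exact: rectsT.
  - by exists setT; [exact: rectsT|exists setT; [exact: rectsT|rewrite setXTT]].
congr (<<s _ >>); apply/seteqP; split.
  move=> _ [A mA [_ [_ [B mB <-] [_ [C mC <-]] <-]] <-].
  exists (fun u => if u is b :: u' then (if b then C u' else B u') else A) => //.
  by move=> [//|[] u].
move=> _ [B mB <-] /=; exists (B [::]) => //.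
exists (clock_rect n (fun u : seq bool => B (false :: u)) `*` clock_rect n (fun u : seq bool => B (true :: u))) => //.
exists (clock_rect n (fun u : seq bool => B (false :: u))); first by eexists; last reflexivity.
by exists (clock_rect n (fun u : seq bool => B (true :: u))) => //; eexists; last reflexivity.
Qed.

(** Two finite measures that agree on a generating pi-system coincide. *)
Lemma clocks_law_unique n (m : {measure set (clocks n) -> \bar R}) :
  (forall B, (forall u, measurable (B u)) ->
    m (clock_rect n B) = (\prod_(u <- short_words n) exp_law R (B u))%E) ->
  forall A, measurable A -> m A = clocks_law n A.
Proof.
move=> mE A mA.
apply/esym/(measure_unique (clock_rects n) (fun _ => setT)) => //.
- exact: measurable_rects.
- exact: rects_setI.
- by move=> _; exact: rectsT.
- by apply/seteqP; split=> // x _; exists 0%N.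
- by move=> _ [B mB <-]; rewrite mE//; exact: clocks_law_rect.
- by move=> _; rewrite [ltLHS](_ : _ = 1%E) ?ltry//; exact: probability_setT.
Qed.
End clocks.

Section law_of_clocks.
Context (R : realType) d (Omega : measurableType d) (P : probability Omega R).

Lemma measurable_restrict_clocks n (clock : word -> {RV P >-> R}) :
  measurable_fun setT (fun w => restrict_clocks n (fun u => clock u w)).
Proof.
elim: n clock => [|n IH] clock /=; first exact: measurable_cst.
apply/measurable_fun_pair; first exact: measurable_funP.
by apply/measurable_fun_pair; exact: IH (fun u => clock (_ :: u)).
Qed.

(** This is the only place where the independence of the given clocks is
    used: from here on, probabilities of events that depend on finitely many
    clocks are computed with [clocks_law]. *)
Lemma restrict_clocks_law n (clock : word -> {RV P >-> R}) :
  iid_exponential1_clocks clock ->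
  forall A, measurable A ->
    P ((fun w => restrict_clocks n (fun u => clock u w)) @^-1` A) = clocks_law R n A.
Proof.
move=> [indep law].
pose X : {mfun Omega >-> clocks R n} := HB.pack (fun w => restrict_clocks n (fun u => clock u w))
  (isMeasurableFun.Build _ _ _ _ _ (@measurable_restrict_clocks n clock)).
apply: (@clocks_law_unique R n (distribution P X)) => B mB.
transitivity (\prod_(u <- short_words n) P (clock u @^-1` B u))%E; last first.
  by apply: eq_bigr => u _; exact: (law u (B u)).
rewrite -indep//; last exact: short_words_uniq.
congr (P _); apply/seteqP; split=> w /=.
  by move/restrict_clocks_rect => H u; rewrite /= mem_short_words; exact: H.
by move=> H; apply/restrict_clocks_rect => u un; apply: H => /=; rewrite mem_short_words.
Qed.
End law_of_clocks.

(** * Integrals of a branching operation over pairs of independent copies *)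

Section quadratic_pairing.
Context d (T : measurableType d) (R : realType) (mu : probability T R).
Variables (a b : R).
Hypotheses (a0 : 0 <= a) (b0 : 0 <= b).

(** The case [(a, b) = (z, 0)] combines sums over the leaves of the two
    subtrees, weighted by [z^|u|]; the case [(0, 1)] combines products over them. *)
Definition branch_op (x x' : R) : R := a * (x + x') + b * (x * x').

Lemma branch_opC x x' : branch_op x x' = branch_op x' x.
Proof. by rewrite /branch_op addrC (addrC x) (mulrC x) addrC. Qed.

Lemma branch_op_ge0 x x' : 0 <= x -> 0 <= x' -> 0 <= branch_op x x'.
Proof. by move=> x0 x'0; rewrite addr_ge0// mulr_ge0// ?addr_ge0// mulr_ge0. Qed.

Lemma branch_op_le x1 x2 x1' x2' : 0 <= x1 -> 0 <= x1' -> x1 <= x2 -> x1' <= x2' ->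
  branch_op x1 x1' <= branch_op x2 x2'.
Proof.
move=> x10 x10' x12 x12'; rewrite lerD// ler_wpM2l//; first exact: lerD.
exact: ler_pM.
Qed.

Lemma measurable_branch_op d' (U : measurableType d') (f g : U -> R) :
  measurable_fun setT f -> measurable_fun setT g ->
  measurable_fun setT (fun x => branch_op (f x) (g x)).
Proof.
move=> mf mg; apply: measurable_funD.
  by apply: measurable_funM => //; exact: measurable_funD.
by apply: measurable_funM => //; exact: measurable_funM.
Qed.

(** With one argument constant the operation is affine with nonnegative slope
    in the other, hence preserves inequalities between integrals. *)
Lemma le_integral_branch_op (B : set T) (X X' : T -> R) (c : R) :
  measurable B -> measurable_fun setT X -> measurable_fun setT X' ->
  (forall x, 0 <= X x) -> (forall x, 0 <= X' x) -> 0 <= c ->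
  (\int[mu]_(x in B) (X' x)%:E <= \int[mu]_(x in B) (X x)%:E)%E ->
  (\int[mu]_(x in B) (branch_op (X' x) c)%:E <= \int[mu]_(x in B) (branch_op (X x) c)%:E)%E.
Proof.
move=> mB mX mX' X0 X'0 c0 le.
have E (Y : T -> R) : measurable_fun setT Y -> (forall x, 0 <= Y x) ->
    (\int[mu]_(x in B) (branch_op (Y x) c)%:E =
     \int[mu]_(x in B) (a * c)%:E + (a + b * c)%:E * \int[mu]_(x in B) (Y x)%:E)%E.
  move=> mY Y0.
  have mYE : measurable_fun B (fun x => (Y x)%:E).
    by apply: measurable_fun_EFin; exact: measurable_funTS.
  rewrite -ge0_integralZl//; last 2 first.
  - by move=> x _; rewrite lee_fin.
  - by rewrite lee_fin addr_ge0// mulr_ge0.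
  rewrite -ge0_integralD//.
  - by apply: eq_integral => x _; rewrite -EFinM -EFinD; congr (_%:E); rewrite /branch_op; ring.
  - by move=> x _; rewrite lee_fin mulr_ge0.
  - by move=> x _; rewrite -EFinM lee_fin mulr_ge0// addr_ge0// mulr_ge0.
  - exact: emeasurable_funM.
rewrite !E// leeD2l// lee_wpmul2l// lee_fin addr_ge0// mulr_ge0//.
Qed.
End quadratic_pairing.

Section sections.
Context d1 d2 (T1 : measurableType d1) (T2 : measurableType d2) (R : realType).
Variables (m1 : probability T1 R) (m2 : probability T2 R).
Local Open Scope ereal_scope.

(** Events measurable with respect to the past are not products, so
    integrals over them are disintegrated along their sections. *)
Lemma prod_prob_integral_xsection (A : set (T1 * T2)) (f : T1 * T2 -> \bar R) :
  measurable A -> measurable_fun setT f -> (forall p, 0 <= f p) ->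
  \int[prod_prob m1 m2]_(p in A) f p =
  \int[m1]_x \int[m2]_(y in xsection A x) f (x, y).
Proof.
move=> mA mf f0; rewrite integral_mkcond prod_prob_integral.
- apply: eq_integral => x _; rewrite [RHS]integral_mkcond.
  by apply: eq_integral => y _; rewrite !patchE mem_xsection.
- by apply/(measurable_restrictT _ mA); exact: measurable_funTS.
- by move=> p; rewrite patchE; case: ifP.
Qed.

Lemma prod_prob_integral_ysection (A : set (T1 * T2)) (f : T1 * T2 -> \bar R) :
  measurable A -> measurable_fun setT f -> (forall p, 0 <= f p) ->
  \int[prod_prob m1 m2]_(p in A) f p =
  \int[m2]_y \int[m1]_(x in ysection A y) f (x, y).
Proof.
move=> mA mf f0; rewrite integral_mkcond prod_prob_integral_sym.
- apply: eq_integral => x _; rewrite [RHS]integral_mkcond.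
  by apply: eq_integral => y _; rewrite !patchE mem_ysection.
- by apply/(measurable_restrictT _ mA); exact: measurable_funTS.
- by move=> p; rewrite patchE; case: ifP.
Qed.

Lemma measurable_integral_xsection (A : set (T1 * T2)) (f : T1 * T2 -> \bar R) :
  measurable A -> measurable_fun setT f -> (forall p, 0 <= f p) ->
  measurable_fun setT (fun x => \int[m2]_(y in xsection A x) f (x, y)).
Proof.
move=> mA mf f0.
rewrite (_ : (fun x => _) = (fun x => \int[m2]_y (f \_ A) (x, y))).
  apply: measurable_fun_fubini_tonelli_F.
    by apply/(measurable_restrictT _ mA); exact: measurable_funTS.
  by move=> p; rewrite patchE; case: ifP.
apply/funext => x; rewrite integral_mkcond.
by apply: eq_integral => y _; rewrite !patchE mem_xsection.
Qed.

Lemma measurable_integral_ysection (A : set (T1 * T2)) (f : T1 * T2 -> \bar R) :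
  measurable A -> measurable_fun setT f -> (forall p, 0 <= f p) ->
  measurable_fun setT (fun y => \int[m1]_(x in ysection A y) f (x, y)).
Proof.
move=> mA mf f0.
rewrite (_ : (fun x => _) = (fun y => \int[m1]_x (f \_ A) (x, y))).
  apply: measurable_fun_fubini_tonelli_G.
    by apply/(measurable_restrictT _ mA); exact: measurable_funTS.
  by move=> p; rewrite patchE; case: ifP.
apply/funext => x; rewrite integral_mkcond.
by apply: eq_integral => y _; rewrite !patchE mem_ysection.
Qed.

Lemma le_prod_integral_x (A : set (T1 * T2)) (f g : T1 * T2 -> \bar R) :
  measurable A -> measurable_fun setT f -> (forall p, 0 <= f p) ->
  measurable_fun setT g -> (forall p, 0 <= g p) ->
  (forall x, \int[m2]_(y in xsection A x) f (x, y) <= \int[m2]_(y in xsection A x) g (x, y)) ->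
  \int[prod_prob m1 m2]_(p in A) f p <= \int[prod_prob m1 m2]_(p in A) g p.
Proof.
move=> mA mf f0 mg g0 le; rewrite !prod_prob_integral_xsection//.
apply: ge0_le_integral => //.
- by move=> x _; apply: integral_ge0.
- exact: measurable_integral_xsection.
- exact: measurable_integral_xsection.
Qed.

Lemma le_prod_integral_y (A : set (T1 * T2)) (f g : T1 * T2 -> \bar R) :
  measurable A -> measurable_fun setT f -> (forall p, 0 <= f p) ->
  measurable_fun setT g -> (forall p, 0 <= g p) ->
  (forall y, \int[m1]_(x in ysection A y) f (x, y) <= \int[m1]_(x in ysection A y) g (x, y)) ->
  \int[prod_prob m1 m2]_(p in A) f p <= \int[prod_prob m1 m2]_(p in A) g p.
Proof.
move=> mA mf f0 mg g0 le; rewrite !prod_prob_integral_ysection//.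
apply: ge0_le_integral => //.
- by move=> x _; apply: integral_ge0.
- exact: measurable_integral_ysection.
- exact: measurable_integral_ysection.
Qed.
End sections.

Section pairing.
Context d (T : measurableType d) (R : realType) (mu : probability T R).
Variables (a b : R).
Hypotheses (a0 : 0 <= a) (b0 : 0 <= b).

(** Replaces the two coordinates one after the other.  Only comparisons of
    integrals over sections are available, which is what an induction over
    adapted events provides. *)
Lemma le_integral_pairing (A : set (T * T)) (X X' : T -> R) :
  measurable A -> measurable_fun setT X -> measurable_fun setT X' ->
  (forall x, 0 <= X x) -> (forall x, 0 <= X' x) ->
  (forall y, \int[mu]_(x in ysection A y) (X' x)%:E <= \int[mu]_(x in ysection A y) (X x)%:E)%E ->
  (forall y, \int[mu]_(x in xsection A y) (X' x)%:E <= \int[mu]_(x in xsection A y) (X x)%:E)%E ->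
  (\int[prod_prob mu mu]_(p in A) (branch_op a b (X' p.1) (X' p.2))%:E <=
   \int[prod_prob mu mu]_(p in A) (branch_op a b (X p.1) (X p.2))%:E)%E.
Proof.
move=> mA mX mX' X0 X'0 ley lex.
have m1 (Z : T -> R) : measurable_fun setT Z -> measurable_fun setT (fun p : T * T => Z p.1).
  by move=> mZ; exact: measurableT_comp.
have m2 (Z : T -> R) : measurable_fun setT Z -> measurable_fun setT (fun p : T * T => Z p.2).
  by move=> mZ; exact: measurableT_comp.
apply: (@le_trans _ _ (\int[prod_prob mu mu]_(p in A) (branch_op a b (X p.1) (X' p.2))%:E)%E).
  apply: le_prod_integral_y => //.
  - by apply: measurable_fun_EFin; apply: measurable_branch_op; [exact: m1|exact: m2].
  - by move=> p; rewrite lee_fin branch_op_ge0.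
  - by apply: measurable_fun_EFin; apply: measurable_branch_op; [exact: m1|exact: m2].
  - by move=> p; rewrite lee_fin branch_op_ge0.
  - move=> y /=; apply: le_integral_branch_op => //; exact: measurable_ysection.
apply: le_prod_integral_x => //.
- by apply: measurable_fun_EFin; apply: measurable_branch_op; [exact: m1|exact: m2].
- by move=> p; rewrite lee_fin branch_op_ge0.
- by apply: measurable_fun_EFin; apply: measurable_branch_op; [exact: m1|exact: m2].
- by move=> p; rewrite lee_fin branch_op_ge0.
- move=> x /=; under eq_integral do rewrite branch_opC; under [leRHS]eq_integral do rewrite branch_opC.
  by apply: le_integral_branch_op => //; exact: measurable_xsection.
Qed.
End pairing.

(** * Supermartingales indexed by the leaves of the truncated tree *)

Lemma integral_prob_cst d (T : measurableType d) (R : realType) (P : probability T R) (c : R) :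
  (\int[P]_x cst c%:E x = c%:E)%E.
Proof.
transitivity (c%:E * P setT)%E; first exact: integral_cst.
by rewrite probability_setT mule1.
Qed.

Section truncated_functional.
Context (R : realType) (a b : R).
Hypotheses (a0 : 0 <= a) (b0 : 0 <= b).

(** Value at time [t] of the tree cut at depth [n]: a leaf has the value [y] and
    an internal node combines the values of its children.  Depth overflow gives
    0, so the value is monotone in [n]. *)
Fixpoint tree_fold (n : nat) (y t : R) : clocks R n -> R :=
  match n return clocks R n -> R with
  | 0 => fun=> 0
  | n'.+1 => fun e => if t < e.1 then y else
      branch_op a b (@tree_fold n' y (t - e.1) e.2.1) (@tree_fold n' y (t - e.1) e.2.2)
  end.
Arguments tree_fold : clear implicits.

Lemma tree_fold_ge0 n y t e : 0 <= y -> 0 <= tree_fold n y t e.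
Proof.
move=> y0; elim: n t e => [//|n IH] t e /=; case: ifP => // _.
by apply: branch_op_ge0.
Qed.

Lemma measurable_tree_fold2 n y :
  measurable_fun setT (fun p : R * clocks R n => tree_fold n y p.1 p.2).
Proof.
elim: n => [|n IH]; first exact: measurable_cst.
have m1 : measurable_fun setT (fun p : R * clocks R n.+1 => p.2.1).
  by apply: measurableT_comp => //; exact: measurable_fst.
have mt : measurable_fun setT (fun p : R * clocks R n.+1 => p.1 - p.2.1).
  by apply: measurable_funB.
have m22 : measurable_fun setT (fun p : R * clocks R n.+1 => p.2.2).
  by apply: (measurableT_comp (f := snd)); [exact: measurable_snd|exact: measurable_snd].
have mf : measurable_fun setT (fun p : R * clocks R n.+1 => (p.1 - p.2.1, p.2.2.1)).
  apply/measurable_fun_pair => //.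
  by apply: (measurableT_comp (f := fst)) => //; exact: measurable_fst.
have ms : measurable_fun setT (fun p : R * clocks R n.+1 => (p.1 - p.2.1, p.2.2.2)).
  apply/measurable_fun_pair => //.
  by apply: (measurableT_comp (f := snd)) => //; exact: measurable_snd.
apply: measurable_fun_ifT.
- exact: measurable_fun_ltr.
- exact: measurable_cst.
- by apply: measurable_branch_op; [exact: (measurableT_comp IH mf)|exact: (measurableT_comp IH ms)].
Qed.

Lemma measurable_tree_fold n y t : measurable_fun setT (tree_fold n y t).
Proof.
have mt : measurable_fun setT (fun e : clocks R n => (t, e)).
  by apply/measurable_fun_pair => //; exact: measurable_id.
exact: (measurableT_comp (@measurable_tree_fold2 n y) mt).
Qed.

(** Two arrays of clocks have the same history up to time [t]: the same splits
    up to [t], and nothing is compared beyond. *)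
Fixpoint agree (n : nat) (t : R) : clocks R n -> clocks R n -> Prop :=
  match n return clocks R n -> clocks R n -> Prop with
  | 0 => fun _ _ => True
  | n'.+1 => fun e e' => (t < e.1 /\ t < e'.1) \/
     [/\ e.1 <= t, e.1 = e'.1, @agree n' (t - e.1) e.2.1 e'.2.1 & @agree n' (t - e.1) e.2.2 e'.2.2]
  end.
Arguments agree : clear implicits.

Lemma agree_refl n t e : agree n t e e.
Proof.
elim: n t e => [//|n IH] t e /=; have [et|te] := leP e.1 t; last by left.
by right.
Qed.

Lemma agree_le n s t e e' : s <= t -> agree n t e e' -> agree n s e e'.
Proof.
elim: n s t e e' => [//|n IH] s t e e' st /=.
case=> [[te te']|[et ee' a1 a2]]; first by left; split; exact: le_lt_trans st _.
have [es|se] := leP e.1 s; last by left; rewrite -ee'.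
by right; split => //; apply: IH; try eassumption; rewrite lerD2r.
Qed.

Lemma tree_fold_agree n y s t e e' : s <= t -> agree n t e e' -> tree_fold n y s e = tree_fold n y s e'.
Proof.
move=> st /(agree_le st); elim: n s e e' {st t} => [//|n IH] s e e' /=.
case=> [[-> ->]//|[es <- /IH -> /IH ->]].
by rewrite ltNge es.
Qed.

(** Membership depends on the history up to time [t] only; this replaces the
    filtration generated by the tree. *)
Definition adapted n t (A : set (clocks R n)) :=
  forall e e', agree n t e e' -> A e -> A e'.

Arguments adapted : clear implicits.

Lemma adapted_le n s t A : s <= t -> adapted n s A -> adapted n t A.
Proof. by move=> st sA e e' /(agree_le st); exact: sA. Qed.

Lemma clocks_law_integralS n (A : set (clocks R n.+1)) (f : clocks R n.+1 -> \bar R) :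
  measurable A -> measurable_fun setT f -> (forall p, 0 <= f p)%E ->
  (\int[clocks_law R n.+1]_(p in A) f p =
  \int[exp_law R]_r \int[prod_prob (clocks_law R n) (clocks_law R n)]_(q in xsection A r) f (r, q))%E.
Proof. exact: prod_prob_integral_xsection. Qed.

Lemma exp_law_integral_split (s : R) (F : R -> \bar R) :
  measurable_fun setT F -> (forall r, 0 <= F r)%E ->
  (\int[exp_law R]_r F r =
   \int[exp_law R]_(r in `]-oo, s]) F r + \int[exp_law R]_(r in `]s, +oo[) F r)%E.
Proof.
move=> mF F0; rewrite -ge0_integral_setU//=.
- by rewrite -setCitvr setvU.
- by rewrite -setCitvr setvU.
- by rewrite -setCitvr; first [by apply/disj_setPCl|by apply/disj_setPCr].
Qed.

Variable y : R -> R.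
Hypothesis y0 : forall t, 0 <= y t.
Hypothesis my : measurable_fun setT y.
Hypothesis Hy : forall h s t, 0 <= s -> s <= t ->
  ((y (h + t) * expR (- t))%:E + \int[exp_law R]_(r in `]s, t]) (branch_op a b (y (h + r)) (y (h + r)))%:E
   <= (y (h + s) * expR (- s))%:E)%E.

Lemma measurable_tree_foldE n v t : measurable_fun setT (fun e => (tree_fold n v t e)%:E).
Proof. by apply: measurable_fun_EFin; exact: measurable_tree_fold. Qed.

(** Almost surely the root has not split at time 0. *)
Lemma tree_fold_mean0 n (v : R) : 0 <= v -> (\int[clocks_law R n]_e (tree_fold n v 0 e)%:E <= v%:E)%E.
Proof.
move=> v0; case: n => [|n].
  by rewrite integral0_eq.
have mQ : measurable_fun setT (fun e => (tree_fold n.+1 v 0 e)%:E) by exact: measurable_tree_foldE.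
have Q0 e : (0 <= (tree_fold n.+1 v 0 e)%:E)%E by rewrite lee_fin tree_fold_ge0.
rewrite clocks_law_integralS//; set F := (X in (integral _ _ X <= _)%E).
have mF : measurable_fun setT F by exact: (measurable_integral_xsection _ measurableT mQ Q0).
have F0 r : (0 <= F r)%E by exact: integral_ge0.
rewrite (exp_law_integral_split 0)// null_set_integral//; last 2 first.
  exact: measurable_funTS.
  exact: exp_law_le0.
rewrite add0e (eq_integral (cst v%:E)).
  by rewrite integral_cst// -[leRHS]mule1 lee_wpmul2l ?lee_fin// probability_le1.
move=> r; rewrite inE/= in_itv/= andbT => r0.
rewrite /F (_ : xsection _ _ = setT); last first.
  by apply/seteqP; split=> // q _; rewrite /xsection /= inE.
rewrite (eq_integral (cst v%:E)); last by move=> q _; rewrite /= r0.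
exact: (integral_prob_cst (prod_prob _ _)).
Qed.

(** Condition on the first splitting time [r].  If [r <= s], the induction
    hypothesis applies to both subtrees.  If [r > s], the event is all or
    nothing, the right-hand side is [y (h + s) e^{-s}], and the subtrees born at
    [r] have mean at most [y (h + r)] each at time [t], by the case [s = 0]; the
    hypothesis on [y] then closes the estimate.  The shift [h] is the birth time
    of the subtree. *)
Lemma tree_fold_supermartingale n h s t A : 0 <= s -> s <= t -> measurable A ->
  adapted n s A ->
  (\int[clocks_law R n]_(e in A) (tree_fold n (y (h + t)) t e)%:E <=
   \int[clocks_law R n]_(e in A) (tree_fold n (y (h + s)) s e)%:E)%E.
Proof.
elim: n h s t A => [//|n IH] h s t A s0 st mA aA.
have mQ v u : measurable_fun setT (fun e => (tree_fold n.+1 v u e)%:E) by exact: measurable_tree_foldE.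
have Q0 u e v : (0 <= (tree_fold n.+1 (y u) v e)%:E)%E by rewrite lee_fin tree_fold_ge0.
rewrite (clocks_law_integralS mA (mQ _ _) (Q0 (h + t) ^~ t)).
rewrite (clocks_law_integralS mA (mQ _ _) (Q0 (h + s) ^~ s)).
set F' := (X in (integral _ _ X <= _)%E); set F := (X in (_ <= integral _ _ X)%E).
have mF' : measurable_fun setT F' by exact: (measurable_integral_xsection _ mA (mQ _ _) (Q0 _ ^~ _)).
have mF : measurable_fun setT F by exact: (measurable_integral_xsection _ mA (mQ _ _) (Q0 _ ^~ _)).
have F'0 r : (0 <= F' r)%E by exact: integral_ge0.
have F0 r : (0 <= F r)%E by exact: integral_ge0.
rewrite (exp_law_integral_split s mF' F'0) (exp_law_integral_split s mF F0); apply: leeD.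
  apply: ge0_le_integral => //; try exact: measurable_funTS; try by move=> r _; exact: F'0.
  move=> r rs'; have {rs'} rs : r <= s by move: rs'; rewrite /= in_itv.
  have rt := le_trans rs st.
  rewrite /F' /F.
  under eq_integral do rewrite [tree_fold _ _ _ _]/= ltNge rt [~~ true]/=.
  under [leRHS]eq_integral do rewrite [tree_fold _ _ _ _]/= ltNge rs [~~ true]/=.
  have hE u : h + u = (h + r) + (u - r) by ring.
  rewrite (hE t) (hE s).
  apply: (le_integral_pairing a0 b0 (X := tree_fold n _ _) (X' := tree_fold n _ _)) => //.
  - exact: measurable_xsection.
  - exact: measurable_tree_fold.
  - exact: measurable_tree_fold.
  - by move=> x; exact: tree_fold_ge0.
  - by move=> x; exact: tree_fold_ge0.
  - move=> x; apply: IH; rewrite ?subr_ge0 ?lerD2r//.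
      by apply: measurable_ysection; exact: measurable_xsection.
    move=> e e' ee'; rewrite /ysection /xsection /= !inE /= !inE.
    apply: aA; right; split => //; exact: agree_refl.
  - move=> x; apply: IH; rewrite ?subr_ge0 ?lerD2r//.
      by apply: measurable_xsection; exact: measurable_xsection.
    move=> e e' ee'; rewrite /xsection /= !inE /= !inE.
    apply: aA; right; split => //; exact: agree_refl.
(* The event is adapted at time [s]: if it holds for one array whose root has
   not split at [s], it holds for all of them. *)
have [[e0 se0 Ae0]|An] := pselect (exists2 e, s < e.1 & A e); last first.
  rewrite integral0_eq; first by apply: integral_ge0 => r _; exact: F0.
  move=> r; rewrite /= in_itv/= andbT => sr.
  rewrite /F' (_ : xsection A r = set0) ?integral_set0//.
  apply/seteqP; split=> // q; rewrite /xsection/= inE => Arq.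
  by apply: An; exists (r, q).
have AT r : s < r -> xsection A r = setT.
  move=> sr; apply/seteqP; split=> // q _; rewrite /xsection/= inE.
  by apply: aA Ae0; left.
have t0 : 0 <= t by exact: le_trans st.
have FE : (\int[exp_law R]_(r in `]s, +oo[) F r = (y (h + s) * expR (- s))%:E)%E.
  rewrite (eq_integral (cst (y (h + s))%:E)).
    by rewrite integral_cst//= exp_law_itvy.
  move=> r; rewrite inE/= in_itv/= andbT => sr; rewrite /F AT//.
  rewrite (eq_integral (cst (y (h + s))%:E)); last by move=> q _; rewrite /= sr.
  exact: (integral_prob_cst (prod_prob _ _)).
rewrite FE; apply: le_trans (Hy h s0 st).
have -> : `]s, +oo[%classic = `]s, t] `|` `]t, +oo[ :> set R.
  by rewrite -itv_bndbnd_setU// bnd_simp.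
have dj : [disjoint (`]s, t]%classic : set R) & `]t, +oo[%classic].
  by apply/disj_setPS => r [] /=; rewrite !in_itv/= andbT => /andP[_ rt] /(le_lt_trans rt); rewrite ltxx.
rewrite ge0_integral_setU//; try exact: (measurable_funTS mF'); try by move=> *; exact: F'0.
rewrite addeC leeD//.
  rewrite (eq_integral (cst (y (h + t))%:E)).
    by rewrite integral_cst//= exp_law_itvy.
  move=> r; rewrite inE/= in_itv/= andbT => tr; rewrite /F' AT; last exact: le_lt_trans tr.
  rewrite (eq_integral (cst (y (h + t))%:E)); last by move=> q _; rewrite /= tr.
  exact: (integral_prob_cst (prod_prob _ _)).
have myh : measurable_fun setT (fun r => y (h + r)).
  by apply: (measurableT_comp my); exact: measurable_funD.
apply: ge0_le_integral => //; try exact: measurable_funTS; try by move=> r _; exact: F'0.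
- apply: measurable_funTS; apply: measurable_fun_EFin; exact: measurable_branch_op.
move=> r r'; have {r'} /andP[sr rt] : s < r <= t by move: r'; rewrite /= in_itv.
rewrite /F' AT//.
under eq_integral do rewrite [tree_fold _ _ _ _]/= ltNge rt [~~ true]/=.
apply: (@le_trans _ _ (\int[prod_prob (clocks_law R n) (clocks_law R n)]_q (branch_op a b (cst (y (h + r)) q.1) (cst (y (h + r)) q.2))%:E)%E); last first.
  rewrite le_eqVlt; apply/orP; left; apply/eqP.
  exact: (integral_prob_cst (prod_prob (clocks_law R n) (clocks_law R n)) (branch_op a b (y (h + r)) (y (h + r)))).
have mean : (\int[clocks_law R n]_e (tree_fold n (y (h + t)) (t - r) e)%:E <= (y (h + r))%:E)%E.
  have {1}-> : h + t = (h + r) + (t - r) by ring.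
  apply: (le_trans (IH (h + r) 0 (t - r) setT (lexx _) _ measurableT _)) => //.
    by rewrite subr_ge0.
  rewrite addr0; exact: tree_fold_mean0.
have secT (z : clocks R n) : ysection (setT : set (clocks R n * clocks R n)) z = setT /\
    xsection (setT : set (clocks R n * clocks R n)) z = setT.
  by split; apply/seteqP; split=> // x _; rewrite /ysection /xsection /= inE.
apply: (le_integral_pairing a0 b0 (X' := tree_fold n _ _)) => //.
- exact: measurable_tree_fold.
- by move=> x; exact: y0.
- by move=> x; exact: tree_fold_ge0.
- move=> x; rewrite (secT x).1 integral_prob_cst; exact: mean.
- move=> x; rewrite (secT x).2 integral_prob_cst; exact: mean.
Qed.

End truncated_functional.

(** * A maximal inequality along integer times *)

Section maximal_inequality.
Context (R : realType) (a b : R).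
Hypotheses (a0 : 0 <= a) (b0 : 0 <= b).
Variable y : R -> R.
Hypothesis y0 : forall t, 0 <= y t.
Hypothesis my : measurable_fun setT y.
Hypothesis Hy : forall h s t, 0 <= s -> s <= t ->
  ((y (h + t) * expR (- t))%:E + \int[exp_law R]_(r in `]s, t]) (branch_op a b (y (h + r)) (y (h + r)))%:E
   <= (y (h + s) * expR (- s))%:E)%E.
Variables (n : nat) (x : R).
Hypothesis x0 : 0 <= x.

Let U (j : nat) (e : clocks R n) : R := tree_fold a b (y j%:R) j%:R e.

(** The event that the supermartingale is above [x] at one of the integer
    times from [m] to [m + N]; integer times make it visibly measurable. *)
Fixpoint exceeds (N m : nat) : set (clocks R n) :=
  [set e | x < U m e] `|` (if N is N'.+1 then exceeds N' m.+1 else set0).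

Lemma exceedsP N m e : exceeds N m e <-> exists2 j, (m <= j <= m + N)%N & x < U j e.
Proof.
elim: N m => [|N IH] m /=.
  split=> [[xU|//]|[j]]; first by exists m; rewrite ?leqnn ?leq_addr.
  by rewrite addn0 -eqn_leq => /eqP <-; left.
split=> [[xU|/IH [j /andP[mj jN] xU]]|[j /andP[mj jN] xU]].
- by exists m; rewrite // leqnn leq_addr.
- by exists j => //; rewrite (ltnW mj) addnS -addSn.
- move: mj; rewrite leq_eqVlt => /orP[/eqP mj|mj]; first by left; rewrite /= mj.
  by right; apply/IH; exists j => //; rewrite mj addSn -addnS.
Qed.

Lemma measurable_U j : measurable_fun setT (U j).
Proof. exact: measurable_tree_fold. Qed.

Lemma measurable_gtU m : measurable [set e | x < U m e].
Proof.
have := @measurable_U m measurableT _ (measurable_itv `]x, +oo[).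
rewrite setTI (_ : _ @^-1` _ = [set e | x < U m e])//.
by apply/seteqP; split=> e /=; rewrite in_itv/= andbT.
Qed.

Lemma measurable_exceeds N m : measurable (exceeds N m).
Proof.
elim: N m => [|N IH] m /=; apply: measurableU => //; exact: measurable_gtU.
Qed.

Lemma le_markov_step (A : set (clocks R n)) m : measurable A ->
  (forall e, A e -> x <= U m e) ->
  (x%:E * clocks_law R n A <= \int[clocks_law R n]_(e in A) (U m e)%:E)%E.
Proof.
move=> mA AU; rewrite -integral_cst//; apply: ge0_le_integral => //.
by apply: measurable_fun_EFin; apply: measurable_funTS; exact: measurable_U.
Qed.

(** The first integer time at which [x] is exceeded is handled by Markov's
    inequality; on its complement, which is adapted, the supermartingale property
    passes to the next integer time. *)
Lemma maximal_inequality N m A : measurable A -> adapted m%:R A ->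
  (x%:E * clocks_law R n (A `&` exceeds N m) <=
   \int[clocks_law R n]_(e in A) (U m e)%:E)%E.
Proof.
have U0 j e : (0 <= (U j e)%:E)%E by rewrite lee_fin tree_fold_ge0.
have mU j : measurable_fun setT (fun e => (U j e)%:E).
  by apply: measurable_fun_EFin; exact: measurable_U.
elim: N m A => [|N IH] m A mA aA /=.
  rewrite setU0; apply: (le_trans (@le_markov_step _ m _ _)).
  - by apply: measurableI => //; exact: measurable_gtU.
  - by move=> e [_ /ltW].
  apply: ge0_subset_integral => //.
    by apply: measurableI => //; exact: measurable_gtU.
  exact: measurable_funTS.
set D := [set e | x < U m e].
have mD : measurable D by exact: measurable_gtU.
have mAD : measurable (A `&` D) by exact: measurableI.
have mACD : measurable (A `&` ~` D) by apply: measurableI => //; exact: measurableC.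
have mE := measurable_exceeds N m.+1.
rewrite (_ : A `&` _ = (A `&` D) `|` ((A `&` ~` D) `&` exceeds N m.+1)); last first.
  apply/seteqP; split=> e /=.
    move=> [Ae [De|Ee]]; first by left.
    by have [De|De] := pselect (D e); [left|right].
  by move=> [[Ae De]|[[Ae _] Ee]]; split => //; [left|right].
rewrite measureU//; first last.
  - by apply/seteqP; split=> e //= [[_ De] [[_]]].
  - exact: measurableI.
rewrite ge0_muleDr//.
have -> : (\int[clocks_law R n]_(e in A) (U m e)%:E =
   \int[clocks_law R n]_(e in A `&` D) (U m e)%:E +
   \int[clocks_law R n]_(e in A `&` ~` D) (U m e)%:E)%E.
  rewrite -ge0_integral_setU//.
  - by rewrite -setIUr setUv setIT.
  - by apply: measurable_funTS.
  - by apply/disj_setPS => e [[_ De] [_]].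
apply: leeD.
  by apply: le_markov_step => // e [_ /ltW].
apply: le_trans (IH _ _ mACD _) _.
  apply: (@adapted_le _ _ m%:R); first by rewrite ler_nat.
  move=> e e' ee' [Ae De]; split; first exact: aA ee' Ae.
  by rewrite /D /= /U -(tree_fold_agree a b (y m%:R) (lexx _) ee').
have := @tree_fold_supermartingale _ _ _ a0 b0 y y0 my Hy n 0 m%:R m.+1%:R _ _ _ mACD.
rewrite !add0r; apply => //; first by rewrite ler_nat.
move=> e e' ee' [Ae De]; split; first exact: aA ee' Ae.
by rewrite /D /= /U -(tree_fold_agree a b (y m%:R) (lexx _) ee').
Qed.

End maximal_inequality.

(** * The weights of the three supermartingales, and masses of generations *)

Section leaf_weights.
Variable R : realType.

(** The balance hypothesis of the supermartingale property holds with
    equality when [y' = y - branch_op y y], in integrated form. *)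
Lemma leaf_weight_balance (a b : R) (y : R -> R) :
  0 <= a -> 0 <= b -> (forall t, 0 <= y t) -> continuous y ->
  (forall h r : R, is_derive r 1 (fun r => y (h + r) * expR (- r))
     (- (expR (- r) * branch_op a b (y (h + r)) (y (h + r))))) ->
  forall h s t, 0 <= s -> s <= t ->
  ((y (h + t) * expR (- t))%:E +
   \int[exp_law R]_(r in `]s, t]) (branch_op a b (y (h + r)) (y (h + r)))%:E
   <= (y (h + s) * expR (- s))%:E)%E.
Proof.
move=> a0 b0 y0 cy dy h s t s0 st.
rewrite (@integral_exp_law_FTC R _ (fun r => y (h + r) * expR (- r)))//.
- by rewrite -EFinD lee_fin addrC subrK.
- by move=> x; apply: branch_op_ge0.
- have cyh : continuous (fun r => y (h + r)).
    move=> r; apply: (@continuous_comp _ _ _ (fun r => h + r) y); last exact: cy.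
    by apply: cvgD; [exact: cvg_cst|exact: cvg_id].
  move=> r; rewrite /branch_op; apply: cvgD.
    by apply: cvgMr; apply: cvgD; exact: cyh.
  by apply: cvgMr; apply: cvgM; exact: cyh.
Qed.

(** With the operation [z (x + x')] this gives [M(t, z)]. *)
Definition add_weight (z t : R) : R := expR ((1 - 2 * z) * t).

Lemma continuous_add_weight z : continuous (add_weight z).
Proof.
exact: continuous_expRM.
Qed.

Lemma add_weight_balance (z : R) : 0 <= z ->
  forall h s t, 0 <= s -> s <= t ->
  ((add_weight z (h + t) * expR (- t))%:E +
   \int[exp_law R]_(r in `]s, t]) (branch_op z 0 (add_weight z (h + r)) (add_weight z (h + r)))%:E
   <= (add_weight z (h + s) * expR (- s))%:E)%E.
Proof.
move=> z0; apply: leaf_weight_balance => //.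
- by move=> t; exact: expR_ge0.
- exact: continuous_add_weight.
- move=> h r; rewrite /add_weight.
  apply: is_derive_eq.
  rewrite /GRing.scale /= /branch_op; ring.
Qed.

(** The solutions [y < 1] of [y' = y - y^2]: with the product as operation they
    give the martingale [(1 + l e^{-t})^{-N_t}], which is the conditional Laplace
    transform at [l] of the exponential limit of [N_t e^{-t}] given the tree at
    time [t].  It controls [N_t] from below. *)
Definition mul_weight (l t : R) : R := (1 + l * expR (- t))^-1.

Lemma mul_weight_gt0 (l t : R) : 0 <= l -> 0 < 1 + l * expR (- t).
Proof. by move=> l0; rewrite ltr_pwDl// mulr_ge0// expR_ge0. Qed.

Lemma continuous_mul_weight (l : R) : 0 <= l -> continuous (mul_weight l).
Proof.
move=> l0 t; apply: cvgV; first by rewrite gt_eqF// mul_weight_gt0.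
apply: cvgD; first exact: cvg_cst.
apply: cvgMr; apply: (@continuous_comp _ _ _ -%R expR); first exact: opp_continuous.
exact: continuous_expR.
Qed.

Lemma mul_weight_balance (l : R) : 0 <= l ->
  forall h s t, 0 <= s -> s <= t ->
  ((mul_weight l (h + t) * expR (- t))%:E +
   \int[exp_law R]_(r in `]s, t]) (branch_op 0 1 (mul_weight l (h + r)) (mul_weight l (h + r)))%:E
   <= (mul_weight l (h + s) * expR (- s))%:E)%E.
Proof.
move=> l0; apply: leaf_weight_balance => //.
- by move=> t; rewrite invr_ge0 ltW// mul_weight_gt0.
- exact: continuous_mul_weight.
- move=> h r; rewrite /mul_weight.
  have nz : 1 + l * expR (- (h + r)) != 0 by rewrite gt_eqF// mul_weight_gt0.
  have d1 : is_derive r 1 (fun r => 1 + l * expR (- (h + r))) (- (l * expR (- (h + r)))).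
    apply: is_derive_eq; rewrite /GRing.scale /=; ring.
  have d2 : is_derive r 1 (fun r => (1 + l * expR (- (h + r)))^-1)
     (l * expR (- (h + r)) * (1 + l * expR (- (h + r))) ^- 2).
    apply: is_derive_eq. rewrite /GRing.scale /=. ring.
  apply: is_derive_eq.
  by rewrite /GRing.scale /= /branch_op; field.
Qed.

End leaf_weights.

Section product_integrals.
Context d1 d2 (T1 : measurableType d1) (T2 : measurableType d2) (R : realType).
Variables (P1 : probability T1 R) (P2 : probability T2 R).
Local Open Scope ereal_scope.

Lemma prod_prob_integralM (f : T1 -> R) (g : T2 -> R) :
  measurable_fun setT f -> measurable_fun setT g ->
  (forall x, (0 <= f x)%R) -> (forall x, (0 <= g x)%R) ->
  \int[prod_prob P1 P2]_p (f p.1 * g p.2)%:E =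
  \int[P1]_x (f x)%:E * \int[P2]_x (g x)%:E.
Proof.
move=> mf mg f0 g0.
have mfE := measurable_fun_EFin mf. have mgE := measurable_fun_EFin mg.
rewrite prod_prob_integral; last 2 first.
- apply: measurable_fun_EFin; apply: measurable_funM.
    by apply: (measurableT_comp mf).
  by apply: (measurableT_comp mg).
- by move=> p; rewrite lee_fin mulr_ge0.
under eq_integral do under eq_integral do rewrite EFinM.
rewrite -ge0_integralZr//.
- by apply: eq_integral => x _ /=; rewrite ge0_integralZl// => [y _|]; rewrite lee_fin.
- by move=> x _; rewrite lee_fin.
- by apply: integral_ge0 => x _; rewrite lee_fin.
Qed.

Lemma prod_prob_integral_fst (f : T1 -> R) :
  measurable_fun setT f -> (forall x, (0 <= f x)%R) ->
  \int[prod_prob P1 P2]_p (f p.1)%:E = \int[P1]_x (f x)%:E.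
Proof.
move=> mf f0; under eq_integral do rewrite -(mulr1 (f _)).
rewrite (@prod_prob_integralM f (cst 1%R))//.
by rewrite (integral_prob_cst P2) mule1.
Qed.

Lemma prod_prob_integral_snd (g : T2 -> R) :
  measurable_fun setT g -> (forall x, (0 <= g x)%R) ->
  \int[prod_prob P1 P2]_p (g p.2)%:E = \int[P2]_x (g x)%:E.
Proof.
move=> mf f0; under eq_integral do rewrite -(mul1r (g _)).
rewrite (@prod_prob_integralM (cst 1%R) g)//.
by rewrite (integral_prob_cst P1) mul1e.
Qed.
End product_integrals.

Section generations.
Variables (R : realType) (A : R -> R).
Hypotheses (A0 : forall r, 0 <= A r) (mA : measurable_fun setT A).

(** The total weight of generation [k] in the branching random walk with
    multiplicative steps [A]. *)
Fixpoint gen_mass (k : nat) : clocks R k -> R :=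
  match k return clocks R k -> R with
  | 0 => fun=> 1
  | k'.+1 => fun e => A e.1 * (@gen_mass k' e.2.1 + @gen_mass k' e.2.2)
  end.
Arguments gen_mass : clear implicits.

Lemma gen_mass_ge0 k e : 0 <= gen_mass k e.
Proof. by elim: k e => [//|k IH] e /=; rewrite mulr_ge0// addr_ge0. Qed.

Lemma measurable_gen_mass k : measurable_fun setT (gen_mass k).
Proof.
elim: k => [|k IH]; first exact: measurable_cst.
apply: measurable_funM; first exact: (measurableT_comp mA).
apply: measurable_funD.
  apply: (measurableT_comp IH); exact: (measurableT_comp measurable_fst).
apply: (measurableT_comp IH); exact: (measurableT_comp measurable_snd).
Qed.

Lemma clocks_law_integralM k (f : R -> R) (g : clocks R k * clocks R k -> R) :
  measurable_fun setT f -> measurable_fun setT g ->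
  (forall x, 0 <= f x) -> (forall x, 0 <= g x) ->
  (\int[clocks_law R k.+1]_e (f e.1 * g e.2)%:E =
   \int[exp_law R]_r (f r)%:E * \int[prod_prob (clocks_law R k) (clocks_law R k)]_q (g q)%:E)%E.
Proof. exact: prod_prob_integralM. Qed.

Lemma gen_mass_mean k (m : R) : (\int[exp_law R]_r (A r)%:E = m%:E)%E ->
  (\int[clocks_law R k]_e (gen_mass k e)%:E = ((2 * m) ^+ k)%:E)%E.
Proof.
move=> Am; elim: k => [|k IH].
  by rewrite expr0 (integral_prob_cst (clocks_law R 0)).
have mY1 : measurable_fun setT (fun q : clocks R k * clocks R k => gen_mass k q.1).
  exact: (measurableT_comp (@measurable_gen_mass k) measurable_fst).
have mY2 : measurable_fun setT (fun q : clocks R k * clocks R k => gen_mass k q.2).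
  exact: (measurableT_comp (@measurable_gen_mass k) measurable_snd).
rewrite [LHS](@clocks_law_integralM k A (fun q => gen_mass k q.1 + gen_mass k q.2))//; last 2 first.
- exact: measurable_funD.
- by move=> q; rewrite addr_ge0// gen_mass_ge0.
under [X in (_ * X)%E]eq_integral do rewrite EFinD.
rewrite ge0_integralD//; last 4 first.
- by move=> q _; rewrite lee_fin gen_mass_ge0.
- exact: measurable_fun_EFin.
- by move=> q _; rewrite lee_fin gen_mass_ge0.
- exact: measurable_fun_EFin.
rewrite prod_prob_integral_fst ?prod_prob_integral_snd//; try exact: measurable_gen_mass; try exact: gen_mass_ge0.
by rewrite Am IH -EFinD -EFinM; congr (_%:E); rewrite exprS; ring.
Qed.
End generations.

(** * Inequalities between powers *)

Section power_inequalities.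
Variable R : realType.
Implicit Types a b x z t : R.

Lemma powR_gt0E a t : 0 < a -> a `^ t = expR (t * ln a).
Proof. by move=> a0; rewrite /powR gt_eqF. Qed.

Lemma powR_le1Dx x t : 0 <= x -> 0 < t -> t <= 1 -> x `^ t <= 1 + x.
Proof.
move=> x0 t0 t1; have [x1|x1] := leP 1 x.
  by apply: le_trans (ler1_powR x1 t1) _; rewrite lerDr.
rewrite (@le_trans _ _ 1)// ?lerDl//.
have := @ge0_ler_powR R t (ltW t0) x 1.
by rewrite powR1; apply; rewrite ?nnegrE// ltW.
Qed.

Lemma powR_add_ratio (u d L s : R) : 0 < u -> u <= s -> 0 <= d ->
  L <= ln (s / u) -> u * (s `^ (- d)) * (1 + d * L) <= u `^ (1 - d).
Proof.
move=> u0 us d0 Ls; have s0 : 0 < s by exact: lt_le_trans us.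
rewrite !powR_gt0E// mulrBl mul1r expRD lnK ?posrE// -mulrA.
apply: ler_wpM2l; first exact: ltW.
rewrite -ler_pdivlMl ?expR_gt0// -expRN -expRD.
have -> : - (- d * ln s) + - (d * ln u) = d * (ln s - ln u) by ring.
rewrite -ln_div ?posrE//; apply: le_trans (expR_ge1Dx _).
by rewrite lerD2l ler_wpM2l.
Qed.

(** With [s = a + b], write [a^{1-d} + b^{1-d}] as [s^{1-d}] times
    [(a/s) (s/a)^d + (b/s) (s/b)^d], and bound each power below by
    [1 + d ln (s/a)], [1 + d ln (s/b)]. *)
Lemma powR_split_add (a b d L : R) : 0 < a -> 0 < b -> 0 <= d ->
  L <= ln ((a + b) / a) -> L <= ln ((a + b) / b) ->
  (a + b) `^ (1 - d) * (1 + d * L) <= a `^ (1 - d) + b `^ (1 - d).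
Proof.
move=> a0 b0 d0 La Lb; have s0 : 0 < a + b by exact: addr_gt0.
have -> : (a + b) `^ (1 - d) = (a + b) * (a + b) `^ (- d).
  by rewrite !powR_gt0E// mulrBl mul1r expRD lnK ?posrE// mulNr.
rewrite !mulrDl lerD//; apply: powR_add_ratio => //.
  by rewrite lerDl ltW.
by rewrite lerDr ltW.
Qed.

Lemma powR_subadd (a b t : R) : 0 <= a -> 0 <= b -> 0 < t -> t <= 1 ->
  (a + b) `^ t <= a `^ t + b `^ t.
Proof.
move=> a0 b0 t0 t1.
move: a0; rewrite le_eqVlt => /predU1P[<-|a0].
  by rewrite add0r lerDr powR_ge0.
move: b0; rewrite le_eqVlt => /predU1P[<-|b0].
  by rewrite addr0 lerDl powR_ge0.
have := @powR_split_add a b (1 - t) 0 a0 b0 _ _ _.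
rewrite mulr0 addr0 mulr1 (_ : 1 - (1 - t) = t); last by ring.
by apply; rewrite ?subr_ge0// ln_ge0// ler_pdivlMr// mul1r ?lerDl ?lerDr ltW.
Qed.

(** Strict subadditivity of powers below 1, with a gain linear in [d] that is
    uniform on a compact set of arguments. *)
Lemma powR_deficit (e K a b d : R) : 0 < e -> 1 <= 2 * K -> 0 <= d -> d <= 1 ->
  e <= a -> a <= K -> e <= b -> b <= K ->
  (a + b) `^ (1 - d) + d * (e / K * ln (1 + e / K)) <= a `^ (1 - d) + b `^ (1 - d).
Proof.
move=> e0 K1 d0 d1 ea aK eb bK.
have K0 : 0 < K by lra.
have a0 : 0 < a by lra.
have b0 : 0 < b by lra.
have s0 : 0 < a + b by lra.
set L := ln (1 + e / K).
have eK : 0 < e / K by exact: divr_gt0.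
have L0 : 0 <= L by apply: ln_ge0; lra.
have ratio u v : 0 < u -> u <= K -> e <= v -> L <= ln ((u + v) / u).
  move=> u0 uK ev; rewrite ler_ln ?posrE; [|lra|apply: divr_gt0; lra].
  rewrite mulrDl divff ?gt_eqF// lerD2l.
  apply: ler_pM => //; [exact: ltW|by rewrite invr_ge0 ltW|].
  by rewrite lef_pV2 ?posrE.
have La := ratio a b a0 aK eb.
have Lb : L <= ln ((a + b) / b) by rewrite (addrC a); exact: ratio.
apply: le_trans (powR_split_add a0 b0 d0 La Lb).
rewrite mulrDr mulr1 lerD2l (mulrCA _ d) ler_wpM2l// ler_wpM2r//.
have -> : (a + b) `^ (1 - d) = (a + b) * (a + b) `^ (- d).
  by rewrite !powR_gt0E// mulrBl mul1r expRD lnK ?posrE// mulNr.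
have -> : e / K = (e + e) * (2 * K)^-1 by field; rewrite gt_eqF.
apply: ler_pM; [lra|by rewrite invr_ge0; lra|lra|].
rewrite powRN lef_pV2 ?posrE ?powR_gt0//; last lra.
apply: (@le_trans _ _ ((2 * K) `^ d)).
  by apply: ge0_ler_powR; rewrite ?nnegrE//; lra.
by apply: ler1_powR.
Qed.

Lemma expR_le_quadratic x : x <= 2^-1 -> expR x <= 1 + x + 2 * x ^+ 2.
Proof.
move=> x2; have x1 : 0 < 1 - x by lra.
have : expR x <= (1 - x)^-1.
  by rewrite -[x in expR x]opprK expRN lef_pV2 ?posrE ?expR_gt0// expR_ge1Dx.
move=> /le_trans; apply; rewrite -[leLHS]mul1r ler_pdivrMr//.
have : 0 <= x ^+ 2 * (1 - 2 * x) by rewrite mulr_ge0 ?sqr_ge0//; lra.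
lra.
Qed.

End power_inequalities.

(** * Masses of generations get small in probability *)

Section critical_moments.
Variable R : realType.
Variable z : R.
Hypothesis z0 : 0 < z.

(** The factor picked up by a node that splits after a delay [r]: the weight
    [z] of one more unit of depth, and the normalization [e^{(1 - 2 z) r}]. *)
Definition branch_weight (r : R) : R := z * expR ((1 - 2 * z) * r).
Local Notation A := branch_weight.

Lemma branch_weight_gt0 r : 0 < A r.
Proof. by rewrite mulr_gt0// expR_gt0. Qed.

Lemma branch_weight_ge0 r : 0 <= A r.
Proof. exact/ltW/branch_weight_gt0. Qed.

Lemma measurable_branch_weight : measurable_fun setT A.
Proof.
apply: measurable_funM => //; apply: continuous_measurable_fun.
exact: continuous_expRM.
Qed.

(** The moment of order [1 - d] of [branch_weight] under the exponential law. *)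
Definition branch_moment (d : R) : R := z `^ (1 - d) / (1 + (1 - d) * (2 * z - 1)).

Lemma branch_moment_denom d : 0 <= d -> d <= 1 ->
  Num.min 1 (2 * z) <= 1 + (1 - d) * (2 * z - 1).
Proof.
move=> d0 d1; rewrite ge_min; apply/orP.
have [z1|z1] := leP (2 * z) 1; [right|left].
  have : 0 <= d * (1 - 2 * z) by rewrite mulr_ge0//; lra.
  lra.
have : 0 <= (1 - d) * (2 * z - 1) by rewrite mulr_ge0//; lra.
lra.
Qed.

Lemma branch_moment_denom_gt0 d : 0 <= d -> d <= 1 ->
  0 < 1 + (1 - d) * (2 * z - 1).
Proof.
move=> d0 d1; apply: lt_le_trans (branch_moment_denom d0 d1).
by rewrite lt_min ltr01 mulr_gt0.
Qed.

Lemma integral_branch_moment d : 0 <= d -> d <= 1 ->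
  (\int[exp_law R]_r (A r `^ (1 - d))%:E = (branch_moment d)%:E)%E.
Proof.
move=> d0 d1.
have E r : A r `^ (1 - d) = z `^ (1 - d) * expR (- ((1 - d) * (2 * z - 1)) * r).
  rewrite /branch_weight powRM ?expR_ge0 ?ltW//; congr (_ * _).
  by rewrite -expRM; congr expR; ring.
under eq_integral do rewrite E EFinM.
rewrite ge0_integralZl//=.
- rewrite integral_exp_law_expR ?EFinM//.
  by have := branch_moment_denom_gt0 d0 d1; lra.
- by apply: measurable_fun_EFin; apply: continuous_measurable_fun; exact: continuous_expRM.
- by rewrite lee_fin powR_ge0.
Qed.

Lemma integral_branch_weight : (\int[exp_law R]_r (A r)%:E = 2^-1%:E)%E.
Proof.
have := @integral_branch_moment 0 (lexx _) ler01.
rewrite /branch_moment subr0 mul1r.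
under eq_integral do rewrite powRr1 ?branch_weight_ge0//.
move=> ->; rewrite powRr1 ?ltW//; congr (_%:E).
have -> : 1 + (2 * z - 1) = 2 * z by ring.
by rewrite invfM mulrCA divff ?mulr1// gt_eqF.
Qed.

Lemma branch_moment_lb d : 0 <= d -> d <= 1 ->
  Num.min z 1 / (1 + 2 * z) <= branch_moment d.
Proof.
move=> d0 d1; have zpos := z0; have D0 := branch_moment_denom_gt0 d0 d1.
apply: ler_pM.
- by rewrite le_min ler01 ltW.
- by rewrite invr_ge0; lra.
- rewrite ge_min; apply/orP; have [z1|z1] := leP 1 z; [right|left].
    by rewrite powR_gt0E// -[leLHS](@expR0 R) ler_expR mulr_ge0 ?subr_ge0// ln_ge0.
  rewrite -[leLHS](powRr1 (ltW z0)); apply: ger_powR; last by lra.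
  by rewrite z0 ltW.
- rewrite lef_pV2 ?posrE//; last lra.
  have : 0 <= d * z by rewrite mulr_ge0// ltW.
  lra.
Qed.

Hypothesis zcrit : 2 * z - 1 <= 2 * z * ln z.

(** At [d = 0] the moment is 1/2, and the derivative of its logarithm has
    the sign of [2 z - 1 - 2 z ln z], which is nonpositive by hypothesis.  Only the
    second order in [d] is left.  This is where the position of [z] with respect
    to the critical interval enters. *)
Lemma branch_moment_ub : exists2 c, 0 < c & exists2 d0, 0 < d0 &
  forall d, 0 <= d -> d <= d0 -> 2 * branch_moment d <= 1 + c * d ^+ 2.
Proof.
have zpos := z0; have zc := zcrit.
set D0 := Num.min 1 (2 * z).
have D00 : 0 < D0 by rewrite lt_min ltr01 mulr_gt0.
(* The quadratic term of the expansion of [z^{-d}], divided by the least value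
   of the denominator; the 1 only makes [c] positive. *)
pose c := 4 * z * (ln z) ^+ 2 / D0 + 1.
have lnn := normr_ge0 (ln z).
have c0 : 0 <= 4 * z * (ln z) ^+ 2 / D0.
  by apply: divr_ge0; [apply: mulr_ge0; [lra|exact: sqr_ge0]|exact: ltW].
exists c; first by rewrite ltr_wpDl.
(* Small enough for [- d ln z <= 1/2], where the quadratic bound on the
   exponential holds. *)
pose d0 := (2 * (1 + `|ln z|))^-1.
have d00 : 0 < d0 by rewrite invr_gt0 mulr_gt0// ltr_pwDl.
exists d0 => // d dge0 dd0.
have d1 : d <= 1.
  apply: (le_trans dd0); rewrite invf_le1; lra.
have D1 := branch_moment_denom dge0 d1; have D2 := branch_moment_denom_gt0 dge0 d1.
rewrite /branch_moment; set D := 1 + (1 - d) * (2 * z - 1) in D1 D2 *.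
have dl : - (d * ln z) <= 2^-1.
  apply: (@le_trans _ _ (d * (1 + `|ln z|))).
    rewrite -mulrN ler_wpM2l//; have := ler_norm (- ln z); rewrite normrN; lra.
  apply: (@le_trans _ _ (d0 * (1 + `|ln z|))).
    by rewrite ler_wpM2r//; lra.
  rewrite /d0 invfM -mulrA mulVf ?mulr1//; lra.
have num : 2 * z `^ (1 - d) <= D + 4 * z * (ln z) ^+ 2 * d ^+ 2.
  rewrite powR_gt0E// mulrBl mul1r expRD lnK ?posrE//.
  have := expR_le_quadratic dl.
  rewrite -(ler_pM2l z0) => /(ler_wpM2l (ler0n R 2)) H.
  have H2 := ler_wpM2l dge0 zcrit.
  rewrite /D; apply: le_trans H _; lra.
rewrite mulrA ler_pdivrMr//; apply: (le_trans num).
rewrite [leRHS]mulrDl mul1r; apply: lerD => //.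
have -> : c * d ^+ 2 * D = 4 * z * ln z ^+ 2 / D0 * d ^+ 2 * D + d ^+ 2 * D.
  by rewrite /c; ring.
have : 4 * z * ln z ^+ 2 * d ^+ 2 <= 4 * z * ln z ^+ 2 / D0 * d ^+ 2 * D.
  have -> : 4 * z * ln z ^+ 2 / D0 * d ^+ 2 * D = (4 * z * ln z ^+ 2 * d ^+ 2) * (D / D0) by ring.
  apply: ler_peMr; last by rewrite ler_pdivlMr ?mul1r.
  by rewrite mulr_ge0 ?sqr_ge0// mulr_ge0 ?sqr_ge0//; lra.
by move=> /le_trans; apply; rewrite lerDl mulr_ge0 ?sqr_ge0// ltW.
Qed.

Local Notation branch_mass := (gen_mass A).

Lemma measurable_branch_mass k : measurable_fun setT (@branch_mass k).
Proof. exact: (measurable_gen_mass measurable_branch_weight). Qed.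

Lemma branch_mass_ge0 k (e : clocks R k) : 0 <= branch_mass e.
Proof. exact: (gen_mass_ge0 branch_weight_ge0). Qed.

Lemma branch_mass_mean k : (\int[clocks_law R k]_e (branch_mass e)%:E = 1)%E.
Proof.
rewrite (gen_mass_mean branch_weight_ge0 measurable_branch_weight k integral_branch_weight).
by rewrite divff// expr1n.
Qed.

Definition moderate k (e K : R) : set (clocks R k) := [set w | e <= branch_mass w <= K].
Arguments moderate : clear implicits.

Lemma measurable_moderate k e K : measurable (moderate k e K).
Proof.
have := @measurable_branch_mass k measurableT _ (measurable_itv `[e, K]).
by rewrite setTI (_ : _ @^-1` _ = moderate k e K)// /moderate; apply/seteqP; split=> w /=; rewrite in_itv.
Qed.

Lemma measurable_powR_comp d (T : measurableType d) (f : T -> R) t :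
  measurable_fun setT f -> measurable_fun setT (fun x => f x `^ t).
Proof. by move=> mf; exact: (measurableT_comp (@measurable_powR R t) mf). Qed.

(** The recursion for the moment of order [1 - d]: subadditivity always, and the
    deficit whenever both subtrees have a moderate mass. *)
Lemma moment_step k (d e K p : R) : 0 <= d -> d < 1 -> 0 < e -> 1 <= 2 * K -> 0 <= p ->
  (p%:E <= clocks_law R k (moderate k e K))%E ->
  (\int[clocks_law R k.+1]_w (branch_mass w `^ (1 - d))%:E
   + (branch_moment d * (d * (e / K * ln (1 + e / K)) * p ^+ 2))%:E <=
   (2 * branch_moment d)%:E * \int[clocks_law R k]_w (branch_mass w `^ (1 - d))%:E)%E.
Proof.
move=> d0 d1 e0 K1 p0 pS; set t := 1 - d; set c := d * _.
have K0 : 0 < K by lra.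
have t0 : 0 < t by rewrite subr_gt0.
have t1 : t <= 1 by rewrite /t lerBlDr lerDl.
have c0 : 0 <= c.
  have eK : 0 <= e / K by rewrite divr_ge0 // ltW.
  by apply: mulr_ge0 => //; apply: mulr_ge0 => //; apply: ln_ge0; rewrite lerDl.
set mu := clocks_law R k; set S := moderate k e K.
have mS : measurable S by exact: measurable_moderate.
have mSS : measurable (S `*` S) by exact: measurableX.
have mY := @measurable_branch_mass k.
have mYt : measurable_fun setT (fun w : clocks R k => branch_mass w `^ t) by exact: measurable_powR_comp.
have mY1 : measurable_fun setT (fun q : clocks R k * clocks R k => branch_mass q.1).
  exact: (measurableT_comp mY measurable_fst).
have mY2 : measurable_fun setT (fun q : clocks R k * clocks R k => branch_mass q.2).
  exact: (measurableT_comp mY measurable_snd).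
have mY1t := measurable_powR_comp t mY1. have mY2t := measurable_powR_comp t mY2.
have mYYt := measurable_powR_comp t (measurable_funD mY1 mY2).
have -> : (\int[clocks_law R k.+1]_w (branch_mass w `^ t)%:E =
    (branch_moment d)%:E * \int[prod_prob mu mu]_q ((branch_mass q.1 + branch_mass q.2) `^ t)%:E)%E.
  rewrite -(integral_branch_moment d0 (ltW d1)).
  rewrite -(@clocks_law_integralM R k (fun r => A r `^ t) (fun q => (branch_mass q.1 + branch_mass q.2) `^ t)).
  - by apply: eq_integral => w _ /=; rewrite powRM ?branch_weight_ge0 ?addr_ge0 ?branch_mass_ge0.
  - by apply: measurable_powR_comp; exact: measurable_branch_weight.
  - exact: mYYt.
  - by move=> r; exact: powR_ge0.
  - by move=> q; exact: powR_ge0.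
have m0 : 0 <= branch_moment d.
  rewrite /branch_moment divr_ge0 ?powR_ge0// ltW// branch_moment_denom_gt0//; exact: ltW.
have -> : ((2 * branch_moment d)%:E = (branch_moment d)%:E * 2%:E)%E by rewrite -EFinM mulrC.
rewrite (EFinM (branch_moment d)) -muleA -ge0_muleDr//; last 2 first.
- by apply: integral_ge0 => q _; rewrite lee_fin powR_ge0.
- by rewrite lee_fin mulr_ge0// sqr_ge0.
apply: lee_wpmul2l; first by rewrite lee_fin.
apply: (@le_trans _ _ (\int[prod_prob mu mu]_q (((branch_mass q.1 + branch_mass q.2) `^ t)%:E + c%:E * (\1_(S `*` S) q)%:E))%E).
  rewrite ge0_integralD//; last 4 first.
  - by move=> q _; rewrite lee_fin powR_ge0.
  - exact: measurable_fun_EFin.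
  - by move=> q _; rewrite mule_ge0 ?lee_fin.
  - by apply: emeasurable_funM => //; apply: measurable_fun_EFin; exact: measurable_indic.
  rewrite leeD2l// ge0_integralZl//; last first.
    by apply: measurable_fun_EFin; exact: measurable_indic.
  rewrite integral_indic// setIT EFinM lee_wpmul2l ?lee_fin//.
  rewrite [leRHS](prod_probE mu mu mS mS) expr2 EFinM.
  by apply: lee_pmul; rewrite ?lee_fin.
apply: (@le_trans _ _ (\int[prod_prob mu mu]_q ((branch_mass q.1 `^ t)%:E + (branch_mass q.2 `^ t)%:E))%E).
  apply: ge0_le_integral => //.
  - by move=> q _; rewrite adde_ge0 ?mule_ge0 ?lee_fin ?powR_ge0.
  - apply: emeasurable_funD; first exact: measurable_fun_EFin.
    by apply: emeasurable_funM => //; apply: measurable_fun_EFin; exact: measurable_indic.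
  - by apply: emeasurable_funD; exact: measurable_fun_EFin.
  - move=> q _; rewrite -EFinM -!EFinD lee_fin indicE.
    have [|_] := boolP (q \in S `*` S).
      rewrite inE => -[/andP[eq1 q1K] /andP[eq2 q2K]]; rewrite mulr1.
      by apply: powR_deficit => //; exact: ltW.
    by rewrite mulr0 addr0; apply: powR_subadd => //; exact: branch_mass_ge0.
rewrite ge0_integralD//; last 4 first.
- by move=> q _; rewrite lee_fin powR_ge0.
- exact: measurable_fun_EFin.
- by move=> q _; rewrite lee_fin powR_ge0.
- exact: measurable_fun_EFin.
rewrite (prod_prob_integral_fst mu mu mYt) ?(prod_prob_integral_snd mu mu mYt)//; try by move=> w; exact: powR_ge0.
by rewrite -mule2n mule_natl.
Qed.

Lemma moment_le2 k (d : R) : 0 <= d -> d < 1 ->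
  (\int[clocks_law R k]_w (branch_mass w `^ (1 - d))%:E <= 2%:E)%E.
Proof.
move=> d0 d1.
apply: (@le_trans _ _ (\int[clocks_law R k]_w (1%:E + (branch_mass w)%:E))%E).
  apply: ge0_le_integral => //.
  - by move=> w _; rewrite lee_fin powR_ge0.
  - by apply: measurable_fun_EFin; apply: measurable_powR_comp; exact: measurable_branch_mass.
  - by apply: emeasurable_funD => //; apply: measurable_fun_EFin; exact: measurable_branch_mass.
  - by move=> w _; rewrite -EFinD lee_fin powR_le1Dx ?branch_mass_ge0//; lra.
rewrite ge0_integralD//; last 2 first.
- by move=> w _; rewrite lee_fin branch_mass_ge0.
- by apply: measurable_fun_EFin; exact: measurable_branch_mass.
by rewrite branch_mass_mean (integral_prob_cst (clocks_law R k) 1).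
Qed.

Lemma moment_fin k (d : R) : 0 <= d -> d < 1 ->
  exists2 i : R, 0 <= i <= 2 & (\int[clocks_law R k]_w (branch_mass w `^ (1 - d))%:E = i%:E)%E.
Proof.
move=> d0 d1; have le2 := @moment_le2 k d d0 d1.
have ge0 : (0 <= \int[clocks_law R k]_w (branch_mass w `^ (1 - d))%:E)%E.
  by apply: integral_ge0 => w _; rewrite lee_fin powR_ge0.
exists (fine (\int[clocks_law R k]_w (branch_mass w `^ (1 - d))%:E)).
  rewrite -!lee_fin fineK ?ge0//; apply/fin_numPlt.
  by rewrite (lt_le_trans _ ge0)// (le_lt_trans le2)// ltry.
rewrite fineK//; apply/fin_numPlt.
by rewrite (lt_le_trans _ ge0)// (le_lt_trans le2)// ltry.
Qed.

(** Otherwise each generation would lower the moment of order [1 - d] by at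
    least [d g / 2], with [g] independent of [d]: the gain of order [d] beats the
    excess of order [d^2] once [d] is small.  But this moment is nonnegative. *)
Lemma moderate_vanishes (e K p : R) : 0 < e -> 1 <= 2 * K -> 0 < p ->
  exists k, (clocks_law R k (moderate k e K) < p%:E)%E.
Proof.
move=> e0 K1 p0; apply: contrapT => /forallNP H.
have zpos := z0.
have pS k : (p%:E <= clocks_law R k (moderate k e K))%E.
  by rewrite leNgt; apply/negP; exact: H.
have K0 : 0 < K by lra.
have [c c0 [d0 d00 ub]] := branch_moment_ub.
set L := e / K * ln (1 + e / K).
have eK : 0 < e / K by rewrite divr_gt0.
have L0 : 0 < L by rewrite mulr_gt0// ln_gt0// ltrDl.
set a0 := Num.min z 1 / (1 + 2 * z).
have a00 : 0 < a0 by rewrite divr_gt0 ?lt_min ?z0 ?ltr01//; lra.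
set g := a0 * (L * p ^+ 2).
have g0 : 0 < g by rewrite mulr_gt0// mulr_gt0// exprn_gt0.
(* The last term makes the excess [2 c d^2] at most half of the gain [d g]. *)
pose d := Num.min (Num.min d0 2^-1) (g / (4 * c)).
have dpos : 0 < d by rewrite !lt_min d00 invr_gt0 ltr0n divr_gt0// mulr_gt0.
have dd0 : d <= d0 by rewrite /d ge_min ge_min lexx.
have d2 : d <= 2^-1 by rewrite /d ge_min ge_min lexx orbT.
have dg : 4 * c * d <= g.
  rewrite mulrC -ler_pdivlMr ?mulr_gt0//; by rewrite /d ge_min lexx orbT.
have d1 : d < 1 by lra.
have dge0 := ltW dpos.
have /choice [i ii] : forall k, exists i : R, 0 <= i <= 2 /\
    (\int[clocks_law R k]_w (branch_mass w `^ (1 - d))%:E = i%:E)%E.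
  by move=> k; have [i] := @moment_fin k d dge0 d1; exists i.
have step k : i k.+1 + d * g / 2 <= i k.
  have := @moment_step k d e K p dge0 d1 e0 K1 (ltW p0) (pS k).
  have [/andP[ik0 ik2] ->] := ii k; have [_ ->] := ii k.+1.
  rewrite -EFinD -EFinM lee_fin -/L.
  have := ub d dge0 dd0.
  have ml := @branch_moment_lb d dge0 (ltW d1).
  move=> /(ler_wpM2r ik0) U T.
  have dL : 0 <= d * L * p ^+ 2 by rewrite mulr_ge0 ?sqr_ge0// mulr_ge0// ltW.
  have := ler_wpM2r dL ml; rewrite -/a0 => V.
  have cd0 : 0 <= c * d ^+ 2 by rewrite mulr_ge0 ?sqr_ge0// ltW.
  have W := ler_wpM2l cd0 ik2.
  have X := ler_wpM2l dge0 dg.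
  have -> : d * g = a0 * (d * L * p ^+ 2) by rewrite /g; ring.
  have X2 : c * d ^+ 2 * 2 <= a0 * (d * L * p ^+ 2) / 2.
    move: X; rewrite /g; lra.
  have T2 : i k.+1 + branch_moment d * (d * L * p ^+ 2) <= 2 * branch_moment d * i k by exact: T.
  lra.
have bound k : i k <= 2 - k%:R * (d * g / 2).
  elim: k => [|k IH]; first by have [/andP[_]] := ii 0%N; lra.
  have := step k; rewrite -(natr1 k); lra.
have k0 : 0 < d * g / 2 by rewrite divr_gt0// mulr_gt0.
pose k := (Num.truncn (2 / (d * g / 2))).+1.
have : 2 / (d * g / 2) < k%:R by exact: truncnS_gt.
rewrite ltr_pdivrMr// => kk.
have [/andP[ik _] _] := ii k.
have := bound k; lra.
Qed.

(** The mass has mean 1, hence is rarely large; it is rarely moderate at some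
    generation; so there it is mostly small. *)
Lemma exists_small_generation (h : R) : 0 < h -> h <= 1 ->
  exists k, ((1 - h)%:E <= \int[clocks_law R k]_w (expR (- branch_mass w))%:E)%E.
Proof.
move=> h0 h1; set e := h / 3; set K := 3 / h.
have e0 : 0 < e by rewrite divr_gt0.
have K0 : 0 < K by rewrite divr_gt0.
have K3 : 3 <= K by rewrite ler_pdivlMr//; lra.
have [k Hk] := @moderate_vanishes e K e e0 ltac:(lra) e0.
exists k; set mu := clocks_law R k.
have mY := @measurable_branch_mass k.
pose S := [set w : clocks R k | branch_mass w < e].
have mS : measurable S.
  have := mY measurableT _ (measurable_itv `]-oo, e[).
  by rewrite setTI (_ : _ @^-1` _ = S)// /S; apply/seteqP; split=> w /=; rewrite in_itv.
pose B := [set w : clocks R k | K < branch_mass w].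
have mB : measurable B.
  have := mY measurableT _ (measurable_itv `]K, +oo[).
  by rewrite setTI (_ : _ @^-1` _ = B)// /B; apply/seteqP; split=> w /=; rewrite in_itv/= andbT.
have muB : (mu B <= (K^-1)%:E)%E.
  have : (K%:E * mu B <= 1)%E.
    rewrite -(branch_mass_mean k) -integral_cst//; apply: (@le_trans _ _ (\int[mu]_(w in B) (branch_mass w)%:E)%E).
      apply: ge0_le_integral => //.
      - by move=> w _; rewrite lee_fin ltW.
      - by apply: measurable_fun_EFin; exact: measurable_funTS.
      - by move=> w Bw; rewrite lee_fin ltW.
    apply: ge0_subset_integral => //; first by apply: measurable_fun_EFin.
    by move=> w _; rewrite lee_fin branch_mass_ge0.
  have Bfin : mu B \is a fin_num by exact: fin_num_measure.
  by rewrite -(fineK Bfin) -EFinM !lee_fin => ?; rewrite -[leRHS]mul1r ler_pdivlMr// mulrC.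
have cover : (1 <= mu S + (mu (moderate k e K) + mu B))%E.
  rewrite -(probability_setT mu).
  have -> : setT = S `|` (moderate k e K `|` B).
    apply/esym/seteqP; split=> // w _; rewrite /S /B /moderate /=.
    by case: (ltP (branch_mass w) e) => ?; [left|right; case: (ltP K (branch_mass w)) => ?; [right|left]].
  have mM := @measurable_moderate k e K.
  apply: (le_trans (measureU2 _ _ _)) => //; first exact: measurableU.
  by rewrite leeD2l//; exact: measureU2.
have Sfin : mu S \is a fin_num by exact: fin_num_measure.
have muS : ((1 - 2 * e)%:E <= mu S)%E.
  have : (1 <= mu S + (e%:E + e%:E))%E.
    apply: (le_trans cover); rewrite leeD2l// leeD//; first exact: ltW.
    by apply: (le_trans muB); rewrite lee_fin /K /e invf_div.
  by rewrite -(fineK Sfin) -!EFinD !lee_fin; lra.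
apply: (@le_trans _ _ (\int[mu]_(w in S) (cst (expR (- e))%:E w))%E).
  rewrite integral_cst//.
  apply: (@le_trans _ _ ((expR (- e))%:E * (1 - 2 * e)%:E)%E); last first.
    by rewrite lee_wpmul2l// lee_fin expR_ge0.
  rewrite -EFinM lee_fin.
  have : 1 - e <= expR (- e) by exact: expR_ge1Dx.
  have e3 : e <= 3^-1 by rewrite /e; lra.
  move=> /(@ler_wpM2r _ (1 - 2 * e)) H.
  apply: le_trans (H _); last by lra.
  have -> : h = 3 * e by rewrite /e; field.
  have : 0 <= e ^+ 2 by exact: sqr_ge0.
  lra.
apply: (@le_trans _ _ (\int[mu]_(w in S) (expR (- branch_mass w))%:E)%E).
  apply: ge0_le_integral => //.
  - by move=> w _; rewrite lee_fin expR_ge0.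
  - apply: measurable_fun_EFin; apply: measurable_funTS.
    by apply: (measurableT_comp (@measurable_expR R)); exact: measurableT_comp.
  - by move=> w Sw; rewrite lee_fin ler_expR lerN2 ltW.
apply: ge0_subset_integral => //.
  apply: measurable_fun_EFin.
  by apply: (measurableT_comp (@measurable_expR R)); exact: measurableT_comp.
Qed.
End critical_moments.

(** * Laplace transforms: from generations to time *)

Section laplace.
Variables (R : realType) (z : R).
Hypothesis z0 : 0 < z.
Local Notation A := (branch_weight z).
Local Notation branch_mass := (gen_mass A).

(** The martingale [M(t, z)] computed from the leaves of depth less than
    [n]. *)
Definition trunc_martingale n (t : R) (e : clocks R n) : R := tree_fold z 0 (add_weight z t) t e.
Arguments trunc_martingale : clear implicits.

Lemma trunc_martingale_ge0 n t e : 0 <= trunc_martingale n t e.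
Proof. by apply: tree_fold_ge0 => //; [exact: ltW|exact: expR_ge0]. Qed.

Lemma measurable_trunc_martingale n t : measurable_fun setT (trunc_martingale n t).
Proof. exact: measurable_tree_fold. Qed.

Lemma tree_fold_scale n (c y t : R) (e : clocks R n) : tree_fold z 0 (c * y) t e = c * tree_fold z 0 y t e.
Proof.
elim: n t e => [|n IH] t e /=; first by rewrite mulr0.
by case: ifP => // _; rewrite !IH /branch_op; ring.
Qed.

Lemma trunc_martingaleS n t (e : clocks R n.+1) : e.1 <= t ->
  trunc_martingale n.+1 t e = A e.1 * (trunc_martingale n (t - e.1) e.2.1 + trunc_martingale n (t - e.1) e.2.2).
Proof.
move=> et; rewrite /trunc_martingale /= ltNge et /=.
have -> : add_weight z t = expR ((1 - 2 * z) * e.1) * add_weight z (t - e.1).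
  by rewrite /add_weight -expRD; congr expR; ring.
by rewrite !tree_fold_scale /branch_op /branch_weight; ring.
Qed.

Lemma trunc_martingale_mean_le n t : 0 <= t ->
  (\int[clocks_law R n]_e (trunc_martingale n t e)%:E <= 1)%E.
Proof.
move=> t0; have z0' := ltW z0.
have aw0 u : 0 <= add_weight z u by exact: expR_ge0.
have maw : measurable_fun setT (add_weight z).
  by apply: continuous_measurable_fun; exact: continuous_add_weight.
have := @tree_fold_supermartingale R z 0 z0' (lexx 0) (add_weight z) aw0 maw (add_weight_balance z0') n 0 0 t setT (lexx _) t0 measurableT.
rewrite add0r addr0 => H; apply: (le_trans (H _)) => //.
apply: (le_trans (tree_fold_mean0 _ _ _ _)) => //.
by rewrite /add_weight mulr0 expR0.
Qed.

Definition laplace n (X : clocks R n -> R) (l : R) : \bar R :=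
  (\int[clocks_law R n]_e (expR (- (l * X e)))%:E)%E.

Lemma laplace_ge0 n X l : (0 <= @laplace n X l)%E.
Proof. by apply: integral_ge0 => e _; rewrite lee_fin expR_ge0. Qed.

Lemma measurable_expRN d (T : measurableType d) (X : T -> R) l :
  measurable_fun setT X -> measurable_fun setT (fun e => (expR (- (l * X e)))%:E).
Proof.
move=> mX; apply: measurable_fun_EFin.
apply: (measurableT_comp (@measurable_expR R)); apply: measurableT_comp => //.
exact: measurable_funM.
Qed.

Lemma laplace_le1 n (X : clocks R n -> R) l : measurable_fun setT X -> (forall e, 0 <= X e) -> 0 <= l ->
  (@laplace n X l <= 1)%E.
Proof.
move=> mX X0 l0; rewrite -[leRHS](integral_prob_cst (clocks_law R n) 1).
apply: ge0_le_integral => //.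
- exact: measurable_expRN.
- by move=> e _; rewrite lee_fin expR_le1 oppr_le0 mulr_ge0.
Qed.

(** Jensen's inequality for the convex function [e^{-l x}], with the tangent at
    the upper bound 1 of the mean. *)
Lemma laplace_jensen n t l : 0 <= t -> 0 <= l ->
  ((expR (- l))%:E <= laplace (trunc_martingale n t) l)%E.
Proof.
move=> t0 l0; set mu := clocks_law R n.
have mX := @measurable_trunc_martingale n t.
have mXE : measurable_fun setT (fun e => (trunc_martingale n t e)%:E) by exact: measurable_fun_EFin.
have H : ((expR (- l) * (1 + l))%:E <=
   laplace (trunc_martingale n t) l + (l * expR (- l))%:E * \int[mu]_e (trunc_martingale n t e)%:E)%E.
  rewrite /laplace -ge0_integralZl//; last 2 first.
  - by move=> e _; rewrite lee_fin trunc_martingale_ge0.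
  - by rewrite lee_fin mulr_ge0// expR_ge0.
  rewrite -ge0_integralD//; last 3 first.
  - exact: measurable_expRN.
  - by move=> e _; rewrite -EFinM lee_fin !mulr_ge0 ?expR_ge0 ?trunc_martingale_ge0.
  - exact: emeasurable_funM.
  rewrite -[leLHS](integral_prob_cst mu); apply: ge0_le_integral => //.
  - by move=> e _; rewrite lee_fin mulr_ge0 ?expR_ge0//; lra.
  - by apply: emeasurable_funD; [exact: measurable_expRN|exact: emeasurable_funM].
  move=> e _; rewrite -EFinM -EFinD lee_fin.
  have -> : - (l * trunc_martingale n t e) = - l + - (l * (trunc_martingale n t e - 1)) by ring.
  rewrite expRD.
  have := expR_ge1Dx (- (l * (trunc_martingale n t e - 1))).
  move=> /(ler_wpM2l (expR_ge0 (- l))); lra.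
have le1 := @trunc_martingale_mean_le n t t0.
have lfin : laplace (trunc_martingale n t) l \is a fin_num.
  rewrite ge0_fin_numE ?laplace_ge0//; apply: le_lt_trans (laplace_le1 _ _ _) _ => //; last exact: ltry.
  by move=> e; exact: trunc_martingale_ge0.
have : ((expR (- l) * (1 + l))%:E <= laplace (trunc_martingale n t) l + (l * expR (- l))%:E)%E.
  apply: (le_trans H); rewrite leeD2l// -[leRHS]mule1 lee_wpmul2l//.
  by rewrite lee_fin mulr_ge0// expR_ge0.
rewrite -(fineK lfin) -EFinD !lee_fin; lra.
Qed.

Lemma clocks_law_integral_iter n (f : clocks R n.+1 -> \bar R) :
  measurable_fun setT f -> (forall p, 0 <= f p)%E ->
  (\int[clocks_law R n.+1]_p f p =
   \int[exp_law R]_r \int[prod_prob (clocks_law R n) (clocks_law R n)]_q f (r, q))%E.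
Proof. exact: prod_prob_integral. Qed.

Lemma measurable_integral_iter n (f : clocks R n.+1 -> \bar R) :
  measurable_fun setT f -> (forall p, 0 <= f p)%E ->
  measurable_fun setT (fun r => \int[prod_prob (clocks_law R n) (clocks_law R n)]_q f (r, q))%E.
Proof. exact: measurable_fun_fubini_tonelli_F. Qed.

Lemma laplace_pair n (X : clocks R n -> R) c : measurable_fun setT X ->
  (\int[prod_prob (clocks_law R n) (clocks_law R n)]_q (expR (- (c * (X q.1 + X q.2))))%:E =
   laplace X c * laplace X c)%E.
Proof.
move=> mX.
have mf : measurable_fun setT (fun e => expR (- (c * X e))).
  apply: (measurableT_comp (@measurable_expR R)); apply: measurableT_comp => //.
  exact: measurable_funM.
rewrite -(@prod_prob_integralM _ _ _ _ R _ _ (fun e => expR (- (c * X e))) (fun e => expR (- (c * X e))))//.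
- by apply: eq_integral => q _; rewrite -expRD; congr (expR _)%:E; ring.
Qed.

Lemma mule_self_le (x y : \bar R) (h : R) : (0 <= x)%E -> (x <= 1)%E -> (0 <= y)%E -> (y <= 1)%E ->
  0 <= h -> (x <= y + h%:E)%E -> (x * x <= y * y + (2 * h)%:E)%E.
Proof.
case: x => [x| |]//; case: y => [y| |]//; rewrite !lee_fin => x0 x1 y0 y1 h0 xy.
have [xley|yltx] := leP x y.
  have := ler_pM x0 x0 xley xley; lra.
have : (x - y) * (x + y) <= h * 2 by apply: ler_pM; lra.
lra.
Qed.

(** By induction on [k], split at the first splitting time [r]: for [r <= t]
    both transforms are squares of transforms at [(k, t - r)], and the event
    [r > t] costs [e^{-t}].  The factor 5 per generation is 4 (the square doubles
    the error, and so does integrating [e^{r/2}]) plus 1 for that event. *)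
Lemma laplace_comparison k n t l : 0 <= t -> 0 <= l ->
  (laplace (@branch_mass k) l <= laplace (trunc_martingale n t) l + (5 ^+ k * expR (- (t / 2)))%:E)%E.
Proof.
have mY j : measurable_fun setT (@branch_mass j) by exact: (measurable_gen_mass (measurable_branch_weight z)).
have Y0 j (e : clocks R j) : 0 <= branch_mass e by exact: (gen_mass_ge0 (branch_weight_ge0 z0)).
have e0 j (u : R) : 0 <= 5 ^+ j * expR (- (u / 2)) by rewrite mulr_ge0 ?exprn_ge0 ?expR_ge0.
elim: k n t l => [|k IH] n t l t0 l0.
  rewrite expr0 mul1r.
  have -> : laplace (@branch_mass 0) l = (expR (- l))%:E.
    rewrite /laplace -(integral_prob_cst (clocks_law R 0)).
    by apply: eq_integral => e _ /=; rewrite mulr1.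
  apply: (le_trans (@laplace_jensen n t l t0 l0)).
  by rewrite leeDl// lee_fin expR_ge0.
case: n => [|n].
  have -> : laplace (trunc_martingale 0 t) l = 1%E.
    rewrite /laplace -(integral_prob_cst (clocks_law R 0) 1).
    by apply: eq_integral => e _ /=; rewrite mulr0 oppr0 expR0.
  apply: (@le_trans _ _ 1%E); first exact: laplace_le1.
  by rewrite leeDl// lee_fin.
have mfY := measurable_expRN l (mY k.+1).
have mfM := measurable_expRN l (@measurable_trunc_martingale n.+1 t).
have fY0 p : (0 <= (expR (- (l * @branch_mass k.+1 p)))%:E)%E by rewrite lee_fin expR_ge0.
have fM0 p : (0 <= (expR (- (l * trunc_martingale n.+1 t p)))%:E)%E by rewrite lee_fin expR_ge0.
rewrite /laplace !clocks_law_integral_iter//.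
set F := (X in (integral _ _ X <= _)%E); set G := (X in (_ <= integral _ _ X + _)%E).
have mF : measurable_fun setT F by exact: (measurable_integral_iter mfY fY0).
have mG : measurable_fun setT G by exact: (measurable_integral_iter mfM fM0).
have F0 r : (0 <= F r)%E by exact: integral_ge0.
have G0 r : (0 <= G r)%E by exact: integral_ge0.
have lA r : 0 <= l * A r by rewrite mulr_ge0// branch_weight_ge0.
have FE r : (F r = laplace (@branch_mass k) (l * A r) * laplace (@branch_mass k) (l * A r))%E.
  by rewrite -laplace_pair//; apply: eq_integral => q _; rewrite [branch_mass _]/= mulrA.
have GE r : r <= t -> (G r = laplace (trunc_martingale n (t - r)) (l * A r) * laplace (trunc_martingale n (t - r)) (l * A r))%E.
  move=> rt; rewrite -laplace_pair; last exact: measurable_trunc_martingale.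
  by apply: eq_integral => q _; rewrite trunc_martingaleS//= mulrA.
have F1 r : (F r <= 1)%E.
  rewrite FE -[leRHS]mule1; apply: lee_pmul; rewrite ?laplace_ge0//; exact: laplace_le1.
rewrite (exp_law_integral_split t mF F0) (exp_law_integral_split t mG G0).
have tail : (\int[exp_law R]_(r in `]t, +oo[) F r <= (expR (- t))%:E)%E.
  rewrite -exp_law_itvy// -[leRHS]mul1e -integral_cst//.
  by apply: ge0_le_integral => //; exact: measurable_funTS.
have mh : measurable_fun setT (fun r : R => (5 ^+ k * 2 * expR (- (t / 2)) * expR (- (- 2^-1) * r))%:E).
  apply: measurable_fun_EFin; apply: measurable_funM => //.
  by apply: continuous_measurable_fun; exact: continuous_expRM.
have bulk : (\int[exp_law R]_(r in `]-oo, t]) F r <=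
   \int[exp_law R]_(r in `]-oo, t]) G r + (4 * 5 ^+ k * expR (- (t / 2)))%:E)%E.
  have -> : (4 * 5 ^+ k * expR (- (t / 2)))%:E =
      (\int[exp_law R]_r (5 ^+ k * 2 * expR (- (t / 2)) * expR (- (- 2^-1) * r))%:E)%E.
    under eq_integral do rewrite EFinM.
    rewrite ge0_integralZl//; last first.
      by apply: measurable_fun_EFin; apply: continuous_measurable_fun; exact: continuous_expRM.
    rewrite integral_exp_law_expR; last lra.
    rewrite -EFinM; congr (_%:E); have -> : (1 + - 2^-1 : R)^-1 = 2 by field.
    by ring.
  apply: (@le_trans _ _ (\int[exp_law R]_(r in `]-oo, t]) (G r +
      (5 ^+ k * 2 * expR (- (t / 2)) * expR (- (- 2^-1) * r))%:E))%E).
    apply: ge0_le_integral => //.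
    - exact: measurable_funTS.
    - by apply: measurable_funTS; exact: emeasurable_funD.
    move=> r r'; have {r'} rt : r <= t by move: r'; rewrite /= in_itv.
    rewrite FE GE//.
    have tr : 0 <= t - r by rewrite subr_ge0.
    have := @mule_self_le _ _ _ (laplace_ge0 _ _) (laplace_le1 (mY k) (Y0 k) (lA r))
      (laplace_ge0 _ _) (laplace_le1 (@measurable_trunc_martingale n (t - r)) (@trunc_martingale_ge0 n (t - r)) (lA r))
      (e0 k (t - r)) (IH n (t - r) (l * A r) tr (lA r)).
    move=> /le_trans; apply; rewrite leeD2l// lee_fin.
    have -> : expR (- ((t - r) / 2)) = expR (- (t / 2)) * expR (- (- 2^-1) * r).
      by rewrite -expRD; congr expR; field.
    by rewrite le_eqVlt; apply/orP; left; apply/eqP; ring.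
  rewrite ge0_integralD//; try exact: measurable_funTS.
  rewrite leeD2l//; exact: ge0_subset_integral.
apply: (le_trans (leeD bulk tail)).
rewrite -[leLHS]addeA -EFinD.
apply: leeD; first by rewrite leeDl// integral_ge0.
rewrite lee_fin exprS.
have : expR (- t) <= expR (- (t / 2)) by rewrite ler_expR; lra.
have : expR (- (t / 2)) <= 5 ^+ k * expR (- (t / 2)).
  by rewrite ler_peMl ?expR_ge0// exprn_ege1//; lra.
lra.
Qed.
End laplace.

(** * Almost sure statements, and distinctness of the splitting times *)

Section almost_everywhere.
Context d (T : measurableType d) (R : realType) (P : probability T R).

(** Almost sure properties are proved with no measurability of the property
    itself, by exceptional events of arbitrarily small probability. *)
Lemma ae_of_small (G : T -> Prop) :
  (forall h : R, 0 < h -> exists2 B, measurable B & (P B <= h%:E)%E /\ forall w, ~ B w -> G w) ->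
  {ae P, forall w, G w}.
Proof.
move=> H.
have /choice [B HB] : forall i : nat, exists B, measurable B /\ (P B <= (i.+1%:R^-1)%:E)%E /\ forall w, ~ B w -> G w.
  by move=> i; have [//|B mB [PB BG]] := H i.+1%:R^-1 _; exists B.
have mI : measurable (\bigcap_i B i) by apply: bigcapT_measurable => i; have [] := HB i.
exists (\bigcap_i B i); split => //.
  apply/eqP; rewrite eq_le measure_ge0 andbT.
  apply/lee_addgt0Pr => h h0; rewrite add0e.
  have [i ih] : exists i : nat, i.+1%:R^-1 <= h.
    exists (Num.truncn h^-1); rewrite invf_ple ?posrE//.
    by rewrite ltW// truncnS_gt.
  have [mB [PB _]] := HB i.
  apply: (@le_trans _ _ (P (B i))); last by apply: (le_trans PB); rewrite lee_fin.
  by apply: le_measure; rewrite ?inE//; exact: bigcap_inf.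
move=> w /= nG i _; have [_ [_ BG]] := HB i.
by apply: contrapT => /BG.
Qed.

Lemma ae_forall_count (I : countType) (G : I -> T -> Prop) :
  (forall i, {ae P, forall w, G i w}) -> {ae P, forall w, forall i, G i w}.
Proof.
move=> H.
have : {ae P, forall w, forall n : nat, oapp (G ^~ w) True (@unpickle I n)}.
  apply: ae_foralln => n; case: (unpickle n) => [i|] /=; first exact: H.
  by apply: aeW.
by apply: filterS => w Hw i; have := Hw (pickle i); rewrite pickleK.
Qed.

Lemma measure_bigcup_le (F : nat -> set T) (h : R) :
  (forall n, measurable (F n)) -> (forall m n, (m <= n)%N -> F m `<=` F n) ->
  (forall n, P (F n) <= h%:E)%E -> (P (\bigcup_n F n) <= h%:E)%E.
Proof.
move=> mF ndF PF.
have mU : measurable (\bigcup_n F n) by exact: bigcupT_measurable.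
have ndF' : nondecreasing_seq F by move=> m n mn; apply/subsetPset; exact: ndF.
have cv := nondecreasing_cvg_mu (mu := P) mF mU ndF'.
rewrite -(cvg_lim _ cv)//; apply: lime_le; first by apply/cvg_ex; exists (P (\bigcup_n F n)).
by apply: nearW.
Qed.
End almost_everywhere.

Section split_times.
Variable R : realType.

(** The time at which [u] splits, read off the array of clocks. *)
Fixpoint split_time n (u : word) : clocks R n -> R :=
  match n return clocks R n -> R with
  | 0 => fun=> 0
  | n'.+1 => fun e =>
      if u is c :: u' then e.1 + @split_time n' u' (if c then e.2.2 else e.2.1) else e.1
  end.
Arguments split_time : clear implicits.

Lemma measurable_split_time n u : measurable_fun setT (split_time n u).
Proof.
elim: n u => [|n IH] u; first exact: measurable_cst.
case: u => [|c u]; first exact: measurable_fst.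
apply: measurable_funD; first exact: measurable_fst.
case: c; apply: (measurableT_comp (IH u)).
  exact: (measurableT_comp measurable_snd measurable_snd).
exact: (measurableT_comp measurable_fst measurable_snd).
Qed.

Lemma null_xsection d1 d2 (T1 : measurableType d1) (T2 : measurableType d2)
  (P1 : probability T1 R) (P2 : probability T2 R) (A : set (T1 * T2)) :
  (forall x, P2 (xsection A x) = 0%E) -> prod_prob P1 P2 A = 0%E.
Proof. by move=> H; apply: integral0_eq => x _; exact: H. Qed.

Lemma null_ysection d1 d2 (T1 : measurableType d1) (T2 : measurableType d2)
  (P1 : probability T1 R) (P2 : probability T2 R) (A : set (T1 * T2)) :
  measurable A ->
  (forall y, P1 (ysection A y) = 0%E) -> prod_prob P1 P2 A = 0%E.
Proof.
move=> mA H.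
transitivity (\int[prod_prob P1 P2]_(p in A) cst 1%E p)%E.
  by rewrite integral_cst// mul1e.
rewrite prod_prob_integral_ysection// integral0_eq// => y _.
rewrite [LHS](@integral_cst _ _ _ P1 _ _ 1%E)//; last exact: measurable_ysection.
by rewrite mul1e; exact: H.
Qed.

Lemma measurable_split_eq n u v : measurable [set e | split_time n u e = split_time n v e].
Proof.
have := @measurable_funB _ _ R setT (split_time n u) (split_time n v) (@measurable_split_time n u) (@measurable_split_time n v) measurableT _ (measurable_set1 0).
rewrite setTI (_ : _ @^-1` _ = [set e | split_time n u e = split_time n v e])//.
by apply/seteqP; split=> e /=; [move=> /eqP; rewrite subr_eq0 => /eqP|move=> ->; rewrite subrr].
Qed.

Lemma measurable_split_cst n u c : measurable [set e | split_time n u e = c].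
Proof.
have := @measurable_split_time n u measurableT _ (measurable_set1 c).
by rewrite setTI.
Qed.

(** The clock of the root enters additively and has no atom. *)
Lemma split_atomless n u c : (size u < n)%N ->
  clocks_law R n [set e | split_time n u e = c] = 0%E.
Proof.
case: n => [//|n] _.
apply: (null_ysection (P1 := exp_law R)); first exact: (@measurable_split_cst n.+1 u c).
move=> q; case: u => [|b u].
  by rewrite (_ : ysection _ _ = [set c]) ?exp_law_set1//; apply/seteqP; split=> r; rewrite /ysection/= inE.
rewrite (_ : ysection _ _ = [set c - split_time n u (if b then q.2 else q.1)]) ?exp_law_set1//.
apply/seteqP; split=> r; rewrite /ysection/= inE/=.
  by move=> <-; rewrite addrK.
by move=> ->; rewrite subrK.
Qed.

(** If the two words start with the same letter, remove it.  Otherwise one of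
    the two times depends on a subtree independent of the other and has no
    atom. *)
Lemma split_distinct n u v : u != v -> (size u < n)%N -> (size v < n)%N ->
  clocks_law R n [set e | split_time n u e = split_time n v e] = 0%E.
Proof.
elim: n u v => [//|n IH] u v uv su sv.
apply: (null_xsection (exp_law R)) => r.
wlog : u v uv su sv / (u = [::] \/ exists u' v', u = false :: u' /\ v = true :: v') \/ exists b u' v', u = b :: u' /\ v = b :: v'.
  move=> H.
  have sym : [set e | split_time n.+1 u e = split_time n.+1 v e] = [set e | split_time n.+1 v e = split_time n.+1 u e].
    by apply/seteqP; split=> e /= ->.
  case: u v uv su sv H sym => [|b u] [|c v] uv su sv H sym.
  - by apply: H => //; left; left.
  - by apply: H => //; left; left.
  - by rewrite sym; apply: H => //; rewrite 1?eq_sym//; left; left.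
  - case: b c uv su sv H sym => -[] uv su sv H sym.
    + by apply: H => //; right; exists true, u, v.
    + by rewrite sym; apply: H => //; rewrite 1?eq_sym//; left; right; exists v, u.
    + by apply: H => //; left; right; exists u, v.
    + by apply: H => //; right; exists false, u, v.
case=> [[u0|[u' [v' [u0 v0]]]]|[b [u' [v' [u0 v0]]]]]; subst u.
- case: v uv sv => [//|b v] _ sv.
  have mS := @measurable_split_cst n v 0.
  have null := @split_atomless n v 0 sv.
  rewrite (_ : xsection _ _ = if b then setT `*` [set e | split_time n v e = 0] else [set e | split_time n v e = 0] `*` setT).
    by case: b {sv}; rewrite prod_probE// null ?mule0 ?mul0e.
  apply/seteqP; split=> q; rewrite /xsection/= inE/=.
    by move=> /eqP; rewrite -{1}[r]addr0 (inj_eq (addrI r)) => /eqP H; case: b {sv} H => /= H; split.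
  by case: b {sv} => /= -[h1 h2]; rewrite ?h1 ?h2 addr0.
- subst v; apply: null_ysection.
    by apply: measurable_xsection; exact: (@measurable_split_eq n.+1).
  move=> y; rewrite (_ : ysection _ _ = [set e | split_time n u' e = split_time n v' y]).
    exact: split_atomless.
  apply/seteqP; split=> q; rewrite /ysection /xsection/= !inE/= ?inE/=; first exact: addrI.
  by move=> ->.
- subst v.
  have uv' : u' != v' by move: uv; apply: contra => /eqP ->.
  have null := IH u' v' uv' su sv.
  have mS := @measurable_split_eq n u' v'.
  rewrite (_ : xsection _ _ = if b then setT `*` [set e | split_time n u' e = split_time n v' e] else [set e | split_time n u' e = split_time n v' e] `*` setT).
    by case: b {uv su sv}; rewrite prod_probE// null ?mule0 ?mul0e.
  apply/seteqP; split=> q; rewrite /xsection/= inE/=.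
    by move=> /addrI H; case: b {uv su sv} H => /= H; split.
  by case: b {uv su sv} => /= -[h1 h2]; rewrite ?h1 ?h2.
Qed.
End split_times.

(** * The Yule tree of one realization of the clocks *)

Section pathwise.
Variable R : realType.
Implicit Types (e : word -> R) (u v : word) (t z : R) (n : nat).

Definition splitting_time e u : R := birth e u + e u.

Lemma birth_nil e : birth e [::] = 0.
Proof. by rewrite /birth big_ord0. Qed.

Lemma birth_cons e b u : birth e (b :: u) = e [::] + birth (subclock e b) u.
Proof.
by rewrite /birth /= big_ord_recl /=; congr (_ + _); apply: eq_bigr.
Qed.

Lemma splitting_cons e b u :
  splitting_time e (b :: u) = e [::] + splitting_time (subclock e b) u.
Proof. by rewrite /splitting_time birth_cons addrA. Qed.

Lemma birth_rcons e u b : birth e (rcons u b) = splitting_time e u.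
Proof.
elim: u e => [|c u IH] e; first by rewrite /= birth_cons /splitting_time !birth_nil add0r addr0.
by rewrite rcons_cons birth_cons IH splitting_cons.
Qed.

Lemma split_restrict n u e : (size u < n)%N ->
  split_time u (restrict_clocks n e) = splitting_time e u.
Proof.
elim: n u e => [//|n IH] [|b u] e /=; first by rewrite /splitting_time birth_nil add0r.
by rewrite ltnS splitting_cons => /IH H; case: b; rewrite H.
Qed.

Definition positive e := forall u, 0 < e u.

Lemma positive_sub e b : positive e -> positive (subclock e b).
Proof. by move=> pe u; exact: pe. Qed.

Lemma birth_ge0 e u : positive e -> 0 <= birth e u.
Proof. by move=> pe; rewrite sumr_ge0// => i _; exact/ltW. Qed.

Lemma birth_lt_splitting e u : positive e -> birth e u < splitting_time e u.
Proof. by move=> pe; rewrite ltrDl. Qed.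

Lemma splitting_gt0 e u : positive e -> 0 < splitting_time e u.
Proof. by move=> pe; apply: le_lt_trans (birth_ge0 u pe) (birth_lt_splitting u pe). Qed.

Lemma birth_cat e u v : positive e -> birth e u <= birth e (u ++ v).
Proof.
elim: u e => [|b u IH] e pe; first by rewrite birth_nil birth_ge0.
by rewrite cat_cons !birth_cons lerD2l IH//; exact: positive_sub.
Qed.

Lemma leaves_yule_tree e t u : positive e ->
  leaves (yule_tree e t) u <-> birth e u <= t < splitting_time e u.
Proof.
move=> pe; rewrite /leaves /yule_tree /=; split=> [[bu nu]|/andP[bu us]].
  rewrite bu /= ltNge; apply/negP => st.
  by apply: (nu [:: true]) => //; rewrite cats1 birth_rcons.
split=> // -[//|b v] _; rewrite -cat_rcons => H.
have := birth_cat (rcons u b) v pe; rewrite birth_rcons => /(lt_le_trans us) /lt_le_trans /(_ H).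
by rewrite ltxx.
Qed.

(** All the leaves at time [t] are then among the words of length less than
    [n], so that the cut tree is the tree. *)
Definition unborn n e t := forall u, size u = n -> t < birth e u.

Lemma unborn0 e t : 0 <= t -> ~ unborn 0 e t.
Proof. by move=> t0 /(_ [::] erefl); rewrite birth_nil ltNge t0. Qed.

Lemma unborn_sub n e t b : unborn n.+1 e t -> unborn n (subclock e b) (t - e [::]).
Proof. by move=> H u un; have := H (b :: u) (congr1 S un); rewrite birth_cons ltrBlDl. Qed.

Lemma unborn_le n e s t : s <= t -> unborn n e t -> unborn n e s.
Proof. by move=> st H u /H; exact: le_lt_trans. Qed.

Lemma unborn_size n e t u : positive e -> unborn n e t -> birth e u <= t -> (size u < n)%N.
Proof.
move=> pe H ut; rewrite ltnNge; apply/negP => nu.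
have := H (take n u) (size_takel nu).
rewrite ltNge (le_trans _ ut)//; have := birth_cat (take n u) (drop n u) pe.
by rewrite cat_take_drop.
Qed.

(** The leaves at time [t] found at depth less than [n], as a list: cardinals
    and sums become computable by recursion on [n]. *)
Fixpoint leaf_seq n e t : seq word :=
  if n is n'.+1 then
    if t < e [::] then [:: [::]] else
    map (cons false) (leaf_seq n' (subclock e false) (t - e [::])) ++
    map (cons true) (leaf_seq n' (subclock e true) (t - e [::]))
  else [::].

Lemma mem_leaf_seq n e t u : positive e -> 0 <= t ->
  (u \in leaf_seq n e t) = (size u < n)%N && (birth e u <= t < splitting_time e u).
Proof.
elim: n e t u => [//|n IH] e t u pe t0 /=.
case: ifPn => [te|].
  rewrite inE; case: u => [|b u].
    by rewrite eqxx /splitting_time birth_nil add0r t0 te.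
  apply/esym/negbTE; rewrite negb_and negb_and -!leNgt; apply/orP; right; apply/orP; left.
  by rewrite -ltNge birth_cons ltr_wpDr// birth_ge0//; exact: positive_sub.
rewrite -leNgt => et; have t0' : 0 <= t - e [::] by rewrite subr_ge0.
case: u => [|b u].
  rewrite mem_cat /splitting_time birth_nil add0r ltNge et andbF.
  by apply/negbTE/negP => /orP[] /mapP[].
rewrite birth_cons splitting_cons -lerBrDl -ltrBlDl [size _]/= ltnS -IH//; last exact: positive_sub.
rewrite mem_cat; apply/orP/idP.
  by case=> /mapP[v + [-> ->]].
by move=> H; case: b H => H; [right|left]; apply: map_f.
Qed.

Lemma leaf_seq_uniq n e t : uniq (leaf_seq n e t).
Proof.
elim: n e t => [//|n IH] e t /=; case: ifP => // _.
rewrite cat_uniq !map_inj_uniq ?IH ?andbT//=; try by move=> x y [].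
by apply/hasPn => _ /mapP[v _ ->]; apply/negP => /mapP[].
Qed.

Lemma leaves_leaf_seq n e t : positive e -> 0 <= t -> unborn n e t ->
  leaves (yule_tree e t) = [set` leaf_seq n e t].
Proof.
move=> pe t0 H; apply/seteqP; split=> u.
  move/(leaves_yule_tree _ _ pe) => but; rewrite /= mem_leaf_seq// but andbT.
  by case/andP: but => ut _; exact: (unborn_size pe H ut).
by rewrite /= mem_leaf_seq// => /andP[_ but]; apply/leaves_yule_tree.
Qed.

Definition leaf_sum z n e t : R := \sum_(u <- leaf_seq n e t) z ^+ size u.

Lemma esum_leaves z n e t : 0 <= z -> positive e -> 0 <= t -> unborn n e t ->
  (\esum_(u in leaves (yule_tree e t)) (z ^+ size u)%:E = (leaf_sum z n e t)%:E)%E.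
Proof.
move=> z0 pe t0 H; rewrite (leaves_leaf_seq pe t0 H).
rewrite (esum_fset (finite_seq _)); last by move=> u _; rewrite lee_fin exprn_ge0.
by rewrite -fsbig_seq ?leaf_seq_uniq// sumEFin.
Qed.

Lemma card_leaves n e t k : positive e -> 0 <= t -> unborn n e t ->
  (leaves (yule_tree e t) #= `I_k)%card <-> size (leaf_seq n e t) = k.
Proof.
move=> pe t0 H; rewrite (leaves_leaf_seq pe t0 H).
have E : ([set` leaf_seq n e t] #= `I_(size (leaf_seq n e t)))%card.
  have -> : [set` leaf_seq n e t] = [set` [fset u in leaf_seq n e t]%fset].
    by apply/seteqP; split=> u /=; rewrite inE.
  by apply/card_eq_fsetP; rewrite card_fseq undup_id// leaf_seq_uniq.
split=> [H1|<-//].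
by apply/card_eq_II; rewrite (card_eq_trans _ H1)// card_eq_sym.
Qed.

Lemma leaf_sumS z n e t : e [::] <= t -> leaf_sum z n.+1 e t =
  z * (leaf_sum z n (subclock e false) (t - e [::]) + leaf_sum z n (subclock e true) (t - e [::])).
Proof.
move=> et; rewrite /leaf_sum /= ltNge et /= big_cat !big_map /= mulrDr !mulr_sumr.
by congr (_ + _); apply: eq_bigr => u _; rewrite exprS.
Qed.

Lemma leaf_sumS_lt z n e t : t < e [::] -> leaf_sum z n.+1 e t = 1.
Proof. by move=> te; rewrite /leaf_sum /= te big_seq1. Qed.

Lemma leaf_sum_ge0 z n e t : 0 <= z -> 0 <= leaf_sum z n e t.
Proof. by move=> z0; rewrite sumr_ge0// => u _; exact: exprn_ge0. Qed.

Lemma tree_fold_leaf_sum z n y e t : tree_fold z 0 y t (restrict_clocks n e) = y * leaf_sum z n e t.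
Proof.
elim: n e t => [|n IH] e t; first by rewrite /leaf_sum big_nil mulr0.
rewrite /=; case: ltP => te; first by rewrite leaf_sumS_lt ?mulr1.
by rewrite leaf_sumS// !IH /branch_op; ring.
Qed.

Lemma tree_fold_leaf_count n y e t : 0 <= t -> unborn n e t ->
  tree_fold 0 1 y t (restrict_clocks n e) = y ^+ size (leaf_seq n e t).
Proof.
elim: n e t => [|n IH] e t t0 H; first by have := unborn0 t0 H.
rewrite /=; case: ltP => te; first by rewrite expr1.
have t0' : 0 <= t - e [::] by rewrite subr_ge0.
rewrite !IH//; try exact: unborn_sub.
by rewrite size_cat !size_map exprD /branch_op; ring.
Qed.

(** A tree cut at a larger depth has more leaves; this lets events be
    taken along increasing [n]. *)
Lemma tree_fold_restrict_mono (a b : R) n y t e : 0 <= a -> 0 <= b -> 0 <= y ->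
  tree_fold a b y t (restrict_clocks n e) <= tree_fold a b y t (restrict_clocks n.+1 e).
Proof.
move=> a0 b0 y0; elim: n e t => [|n IH] e t; first exact: tree_fold_ge0.
rewrite [leLHS]/= [leRHS]/=; case: ifP => // _.
by apply: branch_op_le => //; first [exact: tree_fold_ge0|exact: (IH (subclock e false))|exact: (IH (subclock e true))].
Qed.

Lemma leaf_sum1 n e t : leaf_sum 1 n e t = (size (leaf_seq n e t))%:R.
Proof. by rewrite /leaf_sum; under eq_bigr do rewrite expr1n; rewrite big_const_seq count_predT iter_addr_0. Qed.

(** Each split adds one leaf. *)
Lemma size_leaf_seq n e t : positive e -> 0 <= t -> unborn n e t ->
  size (leaf_seq n e t) = (count (fun u => splitting_time e u <= t) (short_words n)).+1.
Proof.
elim: n e t => [|n IH] e t pe t0 H; first by have := unborn0 t0 H.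
have sp b : (fun u => splitting_time e (b :: u) <= t) =1 (fun u => splitting_time (subclock e b) u <= t - e [::]).
  by move=> u; rewrite splitting_cons lerBrDl.
rewrite /=; case: ltP => te.
  rewrite [splitting_time e [::]]/splitting_time birth_nil add0r leNgt te add0n.
  rewrite count_cat !count_map.
  rewrite (eq_count (a2 := pred0)) ?count_pred0; last first.
    move=> u /=; rewrite splitting_cons; apply/negbTE; rewrite -ltNge.
    by rewrite ltr_wpDr// ltW// splitting_gt0//; exact: positive_sub.
  rewrite (eq_count (a2 := pred0)) ?count_pred0//.
  move=> u /=; rewrite splitting_cons; apply/negbTE; rewrite -ltNge.
  by rewrite ltr_wpDr// ltW// splitting_gt0//; exact: positive_sub.
have t0' : 0 <= t - e [::] by rewrite subr_ge0.
rewrite size_cat !size_map !IH//; try exact: unborn_sub; try exact: positive_sub.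
rewrite [splitting_time e [::]]/splitting_time birth_nil add0r te.
rewrite count_cat !count_map add1n addSn addnS.
by congr (_ + _).+2; apply: eq_count => u /=; rewrite -sp.
Qed.

Lemma leaf_sum_ge1 z n e t : 2^-1 <= z -> 0 <= t -> unborn n e t -> 1 <= leaf_sum z n e t.
Proof.
move=> z2; elim: n e t => [|n IH] e t t0 H; first by have := unborn0 t0 H.
have [te|te] := ltP t (e [::]); first by rewrite leaf_sumS_lt.
have t0' : 0 <= t - e [::] by rewrite subr_ge0.
rewrite leaf_sumS//; have := IH _ _ t0' (unborn_sub false H).
have := IH _ _ t0' (unborn_sub true H) => h1 h2.
have : 2^-1 * 2 <= z * (leaf_sum z n (subclock e false) (t - e [::]) +
   leaf_sum z n (subclock e true) (t - e [::])) by apply: ler_pM => //; lra.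
lra.
Qed.

Lemma leaf_sum_le1 z n e t : 0 <= z -> z <= 2^-1 -> 0 <= t -> leaf_sum z n e t <= 1.
Proof.
move=> z0 z2; elim: n e t => [|n IH] e t t0; first by rewrite /leaf_sum big_nil.
have [te|te] := ltP t (e [::]); first by rewrite leaf_sumS_lt.
have t0' : 0 <= t - e [::] by rewrite subr_ge0.
rewrite leaf_sumS//; have h1 := IH (subclock e false) _ t0'.
have h2 := IH (subclock e true) _ t0'.
have : z * (leaf_sum z n (subclock e false) (t - e [::]) +
   leaf_sum z n (subclock e true) (t - e [::])) <= 2^-1 * 2.
  by apply: ler_pM => //; rewrite ?addr_ge0 ?leaf_sum_ge0//; lra.
lra.
Qed.

(** A split replaces [z^|u|] by [2 z z^|u|], which is not smaller when
    [z >= 1/2]. *)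
Lemma leaf_sum_nondecreasing z n e s t : 2^-1 <= z -> 0 <= s -> s <= t -> unborn n e t ->
  leaf_sum z n e s <= leaf_sum z n e t.
Proof.
move=> z2; elim: n e s t => [|n IH] e s t s0 st H; first by have := unborn0 (le_trans s0 st) H.
have [se|es] := ltP s (e [::]).
  by rewrite leaf_sumS_lt// leaf_sum_ge1//; exact: le_trans st.
have et := le_trans es st.
rewrite !leaf_sumS//; apply: ler_wpM2l; first lra.
by apply: lerD; apply: IH; rewrite ?subr_ge0 ?lerD2r//; exact: unborn_sub.
Qed.

Lemma leaf_sum_nonincreasing z n e s t : 0 <= z -> z <= 2^-1 -> 0 <= s -> s <= t -> unborn n e t ->
  leaf_sum z n e t <= leaf_sum z n e s.
Proof.
move=> z0 z2; elim: n e s t => [|n IH] e s t s0 st H; first by have := unborn0 (le_trans s0 st) H.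
have [se|es] := ltP s (e [::]).
  by rewrite [leRHS]leaf_sumS_lt// leaf_sum_le1//; exact: le_trans st.
have et := le_trans es st.
rewrite !leaf_sumS//; apply: ler_wpM2l; first lra.
by apply: lerD; apply: IH; rewrite ?subr_ge0 ?lerD2r//; exact: unborn_sub.
Qed.

(** A sum of nonnegative terms is at least any one of them; used to bound
    the probability that some word of length [n] is born early. *)
Lemma gen_mass_restrict (A : R -> R) (c : R) n e u : (forall r, A r = expR (- (c * r))) -> size u = n ->
  expR (- (c * birth e u)) <= gen_mass A (restrict_clocks n e).
Proof.
move=> AE; have A0 r : 0 <= A r by rewrite AE expR_ge0.
elim: n e u => [|n IH] e [|b u]//=; first by rewrite birth_nil mulr0 oppr0 expR0.
move=> [un]; rewrite birth_cons mulrDr opprD expRD AE; apply: ler_wpM2l; first exact: expR_ge0.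
have := IH (subclock e b) u un; case: b => /le_trans; apply.
  by rewrite lerDr gen_mass_ge0.
by rewrite lerDl gen_mass_ge0.
Qed.

End pathwise.

(** * Suprema over late integer times *)

Section sup_bounds.
Variable R : realType.

Lemma exceeds_from0 (a b : R) (y : R -> R) (n N : nat) (x : R) :
  0 <= a -> 0 <= b -> (forall t, 0 <= y t) -> measurable_fun setT y ->
  (forall h s t, 0 <= s -> s <= t ->
    ((y (h + t) * expR (- t))%:E + \int[exp_law R]_(r in `]s, t]) (branch_op a b (y (h + r)) (y (h + r)))%:E
     <= (y (h + s) * expR (- s))%:E)%E) -> 0 < x ->
  (clocks_law R n (exceeds a b y x N 0) <= (y 0 / x)%:E)%E.
Proof.
move=> a0 b0 y0 my Hy x0.
have := maximal_inequality a0 b0 y0 my Hy (ltW x0) N (m := 0%N) (measurableT : measurable (setT : set (clocks R n))) (fun _ _ _ _ => I).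
rewrite setTI => /le_trans /(_ (@tree_fold_mean0 R a b a0 b0 n (y 0) (y0 0))).
have mE := measurable_exceeds a b y n x N 0.
have fE : clocks_law R n (exceeds a b y x N 0) \is a fin_num by exact: fin_num_measure.
by rewrite -(fineK fE) -EFinM !lee_fin ler_pdivlMr// mulrC.
Qed.

(** The Laplace transform of the martingale at a late time [m] is close to 1,
    hence [E min(M, x)] is small.  Then apply Markov's inequality where [M] already
    exceeds [x] at time [m], and the maximal inequality where it does not. *)
Lemma exceeds_vanish (z : R) (x h : R) : 0 < z -> 2 * z - 1 <= 2 * z * ln z -> 0 < x -> 0 < h ->
  exists m, forall n N, (clocks_law R n (exceeds z 0 (add_weight z) x N m) <= h%:E)%E.
Proof.
move=> z0 zc x0 h0.
pose g := Num.min 1 (h * x / (2 * (1 + x))).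
have g0 : 0 < g by rewrite lt_min ltr01 divr_gt0 ?mulr_gt0//; lra.
have g1 : g <= 1 by rewrite ge_min lexx.
have gh : 2 * (1 + x) * g <= h * x.
  by rewrite mulrC -ler_pdivlMr ?mulr_gt0 ?ge_min ?lexx ?orbT//; lra.
have [k Hk] := exists_small_generation z0 zc g0 g1.
have [m Hm] : exists m : nat, 5 ^+ k * expR (- (m%:R / 2)) <= g.
  pose m := (Num.truncn ((2 : R) * (5 ^+ k / g))).+1; exists m.
  have km : 5 ^+ k / g <= m%:R / 2.
    by rewrite ler_pdivlMr// mulrC ltW// truncnS_gt.
  have k0 : 0 < (5 ^+ k : R) / g by rewrite divr_gt0// exprn_gt0.
  rewrite expRN ler_pdivrMr ?expR_gt0// mulrC -ler_pdivrMr//.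
  by apply: le_trans km _; apply: le_trans (expR_ge1Dx _); rewrite lerDr.
exists m => n N; set mu := clocks_law R n.
have z0' := ltW z0.
have aw0 u : 0 <= add_weight z u by exact: expR_ge0.
have maw : measurable_fun setT (add_weight z).
  by apply: continuous_measurable_fun; exact: continuous_add_weight.
pose U := trunc_martingale z (n := n) m%:R.
have mU : measurable_fun setT U by exact: measurable_trunc_martingale.
have U0 e : 0 <= U e by exact: trunc_martingale_ge0.
pose D := [set e | x < U e].
have mD : measurable D by exact: (measurable_gtU z 0 (add_weight z)).
have mDC : measurable (~` D) by exact: measurableC.
have aDC : adapted m%:R (~` D).
  by move=> e e' ee'; rewrite /D /= /U /trunc_martingale (tree_fold_agree z 0 (add_weight z m%:R) (lexx _) ee').
set E := exceeds _ _ _ _ _ _.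
have mE : measurable E by exact: measurable_exceeds.
have max2 := maximal_inequality z0' (lexx 0) aw0 maw (add_weight_balance z0') (ltW x0) N mDC aDC.
have max1 : (x%:E * mu (D `&` E) <= x%:E * mu D)%E.
  apply: lee_wpmul2l; first by rewrite lee_fin ltW.
  apply: (le_measure mu); [apply: mem_set; exact: measurableI|exact: mem_set|by move=> e []].
have muE : mu E = (mu (D `&` E) + mu (~` D `&` E))%E.
  rewrite -measureU//; try exact: measurableI.
    by rewrite -setIUl setUv setTI.
  by apply/seteqP; split=> e //= [[De _] [nDe _]].
have mUE : measurable_fun setT (fun e => (U e)%:E) by exact: measurable_fun_EFin.
have mexp : measurable_fun setT (fun e => (expR (- U e))%:E).
  apply: measurable_fun_EFin; apply: (measurableT_comp (@measurable_expR R)).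
  exact: measurableT_comp.
pose f e : \bar R := if x < U e then x%:E else (U e)%:E.
have f0 e : (0 <= f e)%E by rewrite /f; case: ifP => _; rewrite lee_fin// ltW.
have mf : measurable_fun setT f.
  by apply: measurable_fun_ifT => //; exact: measurable_fun_ltr.
have xE : (x%:E * mu E <= \int[mu]_e f e)%E.
  rewrite muE ge0_muleDr//.
  have -> : (\int[mu]_e f e = \int[mu]_(e in D) f e + \int[mu]_(e in ~` D) f e)%E.
    rewrite -ge0_integral_setU//; rewrite ?setUv//.
    by apply/disj_setPS => e [De nDe].
  apply: leeD.
    apply: (le_trans max1); rewrite -integral_cst//.
    apply: ge0_le_integral => //.
    - by move=> e _; rewrite lee_fin ltW.
    - exact: measurable_funTS.
    - by move=> e De; rewrite /f (De : x < U e).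
  apply: (le_trans max2); apply: ge0_le_integral => //.
  - by move=> e _; rewrite lee_fin U0.
  - exact: measurable_funTS.
  - exact: measurable_funTS.
  - by move=> e nDe; rewrite /f ifN//; apply/negP.
have fexp : (\int[mu]_e f e + (1 + x)%:E * \int[mu]_e (expR (- U e))%:E <= (1 + x)%:E)%E.
  rewrite -ge0_integralZl//; last by rewrite lee_fin; lra.
  rewrite -ge0_integralD//; last 2 first.
  - by move=> e _; rewrite -EFinM lee_fin mulr_ge0 ?expR_ge0//; lra.
  - exact: emeasurable_funM.
  rewrite -[leRHS](integral_prob_cst mu); apply: ge0_le_integral => //.
  - by move=> e _; rewrite adde_ge0// -EFinM lee_fin mulr_ge0 ?expR_ge0//; lra.
  - by apply: emeasurable_funD => //; exact: emeasurable_funM.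
  (* Both cases are [min(x, u) + (1 + x) e^{-u} <= 1 + x] for [u >= 0]. *)
  move=> e _; have Ue := U0 e.
  have : expR (- U e) * (1 + U e) <= 1.
    rewrite expRN mulrC ler_pdivrMr ?expR_gt0// mul1r; exact: expR_ge1Dx.
  have ee := expR_ge0 (- U e).
  rewrite /f; case: ltP => xU; rewrite -EFinM -EFinD lee_fin /=.
    have : 0 <= expR (- U e) * (U e - x) by rewrite mulr_ge0//; lra.
    have e1 : expR (- U e) <= 1 by rewrite expR_le1; lra.
    lra.
  move=> H1; have : 0 <= (x - U e) * (1 - expR (- U e)).
    rewrite mulr_ge0//; first lra.
    by rewrite subr_ge0 expR_le1; lra.
  nra.
have lap : ((1 - 2 * g)%:E <= \int[mu]_e (expR (- U e))%:E)%E.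
  have := laplace_comparison z0 k n (ler0n R m) ler01.
  rewrite /laplace; under eq_integral do rewrite mul1r.
  under [X in (_ <= X + _)%E]eq_integral do rewrite mul1r.
  move=> /(le_trans Hk) H.
  have lfin : (\int[mu]_e (expR (- U e))%:E)%E \is a fin_num.
    rewrite ge0_fin_numE; last by apply: integral_ge0 => e _; rewrite lee_fin expR_ge0.
    have := @laplace_le1 R n U 1 mU U0 ler01.
    rewrite /laplace; under eq_integral do rewrite mul1r.
    by move=> /le_lt_trans; apply; exact: ltry.
  move: H; rewrite -/U -/mu -(fineK lfin) -EFinD !lee_fin; lra.
have fE : mu E \is a fin_num by exact: fin_num_measure.
have : ((x%:E * mu E) + (1 + x)%:E * (1 - 2 * g)%:E <= (1 + x)%:E)%E.
  apply: le_trans fexp; apply: leeD => //.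
  by rewrite lee_wpmul2l// lee_fin; lra.
rewrite -(fineK fE) -!EFinM -EFinD !lee_fin => H.
have : x * fine (mu E) <= x * h by lra.
by rewrite ler_pM2l.
Qed.
End sup_bounds.

(** * Almost sure behaviour of the Yule tree *)

Section almost_sure_facts.
Context (R : realType) d (Omega : measurableType d) (P : probability Omega R).
Variable clock : word -> {RV P >-> R}.
Hypothesis Hclock : iid_exponential1_clocks clock.

Definition sample (w : Omega) : word -> R := fun u => clock u w.

Lemma measurable_restrict_preimage n (A : set (clocks R n)) : measurable A ->
  measurable ((fun w => restrict_clocks n (sample w)) @^-1` A).
Proof.
move=> mA; have := @measurable_restrict_clocks _ _ _ P n clock measurableT _ mA.
by rewrite setTI.
Qed.

Lemma ae_positive : {ae P, forall w, positive (sample w)}.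
Proof.
apply: (@ae_forall_count _ _ _ P (seq bool) (fun u w => 0 < sample w u)) => u.
have m0 : measurable (clock u @^-1` `]-oo, 0]).
  have mc : measurable_fun setT (clock u) by exact: measurable_funP.
  have := mc measurableT _ (measurable_itv `]-oo, 0]).
  by rewrite setTI.
exists (clock u @^-1` `]-oo, 0]); split => //.
  have := Hclock.2 u `]-oo, 0]%classic (measurable_itv _).
  by rewrite -exp_lawE exp_law_le0.
by move=> w /= /negP; rewrite -leNgt in_itv/=.
Qed.

Lemma ae_distinct_splits : {ae P, forall w, forall p : word * word, p.1 != p.2 ->
  splitting_time (sample w) p.1 != splitting_time (sample w) p.2}.
Proof.
apply: (@ae_forall_count _ _ _ P (seq bool * seq bool)%type (fun p w => p.1 != p.2 ->
  splitting_time (sample w) p.1 != splitting_time (sample w) p.2)) => -[u v] /=.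
have [->|uv] := eqVneq u v; first by apply: aeW.
pose n := (maxn (size u) (size v)).+1.
have un : (size u < n)%N by rewrite ltnS leq_maxl.
have vn : (size v < n)%N by rewrite ltnS leq_maxr.
have mS := @measurable_split_eq R n u v.
exists ((fun w => restrict_clocks n (sample w)) @^-1` [set e | split_time u e = split_time v e]); split.
- exact: measurable_restrict_preimage.
- by rewrite (restrict_clocks_law Hclock mS) split_distinct.
- move=> w H; apply: contrapT => ne; apply: H => _; apply/eqP => E; apply: ne.
  have E' : split_time u (restrict_clocks n (sample w)) = split_time v (restrict_clocks n (sample w)).
    by rewrite !split_restrict.
  exact: E'.
Qed.

(** The sum over the words [u] of length [n] of [e^{-3 birth u}] has mean
    [(2 / 4)^n], which tends to 0: with high probability no such word is born before
    [K].  The rate 3 is one for which twice the Laplace transform of the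
    exponential law is below 1. *)
Lemma ae_unborn : {ae P, forall w, positive (sample w) -> forall K : nat, exists n, unborn n (sample w) K%:R}.
Proof.
have : {ae P, forall w, forall K : nat, exists n, unborn n (sample w) K%:R}.
  apply: (@ae_forall_count _ _ _ P nat (fun K w => exists n, unborn n (sample w) K%:R)) => K.
  apply: ae_of_small => h h0.
  pose A (r : R) := expR (- (3 * r)).
  have A0 r : 0 <= A r by exact: expR_ge0.
  have mA : measurable_fun setT A.
    rewrite (_ : A = fun r => expR (- 3 * r)); last by apply/funext => r; rewrite /A mulNr.
    by apply: continuous_measurable_fun; exact: continuous_expRM.
  have Am : (\int[exp_law R]_r (A r)%:E = 4^-1%:E)%E.
    under eq_integral do rewrite /A -mulNr.
    by rewrite integral_exp_law_expR; [congr (_^-1)%:E; ring|lra].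
  have [n Hn] : exists n : nat, 2^-1 ^+ n * expR (3 * K%:R) <= h.
    pose n := (Num.truncn (expR (3 * K%:R) / h)).+1; exists n.
    have H1 : expR (3 * K%:R) / h < n%:R by exact: truncnS_gt.
    rewrite exprVn mulrC ler_pdivrMr ?exprn_gt0//.
    rewrite -ler_pdivrMl// mulrC; apply: (le_trans (ltW H1)).
    by rewrite -natrX ler_nat ltnW// ltn_expl.
  have mY := @measurable_gen_mass R A mA n.
  pose c : R := expR (- (3 * K%:R)).
  have c0 : 0 < c by exact: expR_gt0.
  pose B := [set e : clocks R n | c <= gen_mass A e].
  have mB : measurable B.
    have := mY measurableT _ (measurable_itv `[c, +oo[).
    by rewrite setTI (_ : _ @^-1` _ = B)// /B; apply/seteqP; split=> e /=; rewrite in_itv/= andbT.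
  exists ((fun w => restrict_clocks n (sample w)) @^-1` B).
    exact: measurable_restrict_preimage.
  split.
    rewrite (restrict_clocks_law Hclock mB).
    have : (c%:E * clocks_law R n B <= (2^-1 ^+ n)%:E)%E.
      have -> : (2^-1 : R) = 2 * 4^-1 by field.
      rewrite -(gen_mass_mean A0 mA n Am) -integral_cst//.
      have mYE : measurable_fun setT (fun e : clocks R n => (gen_mass A e)%:E) by exact: measurable_fun_EFin.
      apply: (@le_trans _ _ (\int[clocks_law R n]_(e in B) (gen_mass A e)%:E)%E).
        apply: ge0_le_integral => //.
        - by move=> e _; rewrite /cst lee_fin ltW.
        - exact: measurable_funTS.
      apply: ge0_subset_integral => //.
      by move=> e _; rewrite lee_fin gen_mass_ge0.
    have fB : clocks_law R n B \is a fin_num by exact: fin_num_measure.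
    rewrite -(fineK fB) -EFinM !lee_fin => H.
    apply: le_trans Hn; rewrite -[X in _ * expR X]opprK expRN ler_pdivlMr ?expR_gt0//.
    by rewrite mulrC.
  move=> w nB; exists n => u un; rewrite ltNge; apply/negP => uK.
  apply: nB; rewrite /B /=.
  apply: le_trans (@gen_mass_restrict R A 3 n (sample w) u (fun=> erefl) un).
  by rewrite ler_expR lerN2 ler_wpM2l.
by apply: filterS => w H _.
Qed.

(** Transfers a bound that is uniform in the depth of the cut and in the number
    of integer times to an event on the original space. *)
Lemma sup_bound_event (a b : R) (y : R -> R) (x h : R) (m : nat) : 0 <= a -> 0 <= b ->
  (forall t, 0 <= y t) ->
  (forall N, (clocks_law R N (exceeds a b y x N m) <= h%:E)%E) ->
  exists2 B, measurable B & (P B <= h%:E)%E /\ forall w, ~ B w ->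
    forall j n, (m <= j)%N -> tree_fold a b (y j%:R) j%:R (restrict_clocks n (sample w)) <= x.
Proof.
move=> a0 b0 y0 H.
pose F N := (fun w => restrict_clocks N (sample w)) @^-1` (exceeds a b y x N m).
have mE N := measurable_exceeds a b y N x N m.
have mF N : measurable (F N).
  exact: measurable_restrict_preimage.
have mono w j n n' : (n <= n')%N -> tree_fold a b (y j%:R) j%:R (restrict_clocks n (sample w)) <=
    tree_fold a b (y j%:R) j%:R (restrict_clocks n' (sample w)).
  elim: n' => [|n' IH]; first by rewrite leqn0 => /eqP ->.
  rewrite leq_eqVlt => /predU1P[->//|]; rewrite ltnS => /IH /le_trans; apply.
  exact: tree_fold_restrict_mono.
exists (\bigcup_N F N); first exact: bigcupT_measurable.
split.
  apply: measure_bigcup_le => //.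
    move=> N N' NN' w /= /exceedsP [j /andP[mj jN] xQ]; apply/exceedsP.
    exists j; first by rewrite mj (leq_trans jN)// leq_add2l.
    by apply: (lt_le_trans xQ); exact: mono.
  by move=> N; rewrite (restrict_clocks_law Hclock (mE N)).
move=> w nB j n mj; rewrite leNgt; apply/negP => xQ; apply: nB.
exists (maxn n (j - m)) => //; apply/exceedsP; exists j.
  by rewrite mj -leq_subLR leq_maxr.
by apply: (lt_le_trans xQ); apply: mono; exact: leq_maxl.
Qed.

Lemma ae_additive_vanish (z : R) : 0 < z -> 2 * z - 1 <= 2 * z * ln z ->
  {ae P, forall w, forall i : nat, exists m, forall j n, (m <= j)%N ->
     add_weight z j%:R * leaf_sum z n (sample w) j%:R <= i.+1%:R^-1}.
Proof.
move=> z0 zc.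
apply: (@ae_forall_count _ _ _ P nat (fun i w => exists m, forall j n, (m <= j)%N ->
     add_weight z j%:R * leaf_sum z n (sample w) j%:R <= i.+1%:R^-1)) => i.
apply: ae_of_small => h h0.
have i0 : 0 < (i.+1%:R^-1 : R) by rewrite invr_gt0.
have [m Hm] := @exceeds_vanish R z i.+1%:R^-1 h z0 zc i0 h0.
have aw0 u : 0 <= add_weight z u by exact: expR_ge0.
have [B mB [PB HB]] := @sup_bound_event z 0 (add_weight z) i.+1%:R^-1 h m (ltW z0) (lexx 0) aw0 (fun N => Hm N N).
exists B => //; split => // w nB; exists m => j n mj.
by rewrite -tree_fold_leaf_sum; exact: HB.
Qed.

Lemma ae_leaf_count_upper : {ae P, forall w, exists K : R, forall j n,
  (size (leaf_seq n (sample w) j%:R))%:R <= K * expR j%:R}.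
Proof.
apply: ae_of_small => h h0.
have aw0 u : 0 <= add_weight (1 : R) u by exact: expR_ge0.
have maw : measurable_fun setT (add_weight (1 : R)).
  by apply: continuous_measurable_fun; exact: continuous_add_weight.
have h1 : 0 < h^-1 by rewrite invr_gt0.
have bound N : (clocks_law R N (exceeds 1 0 (add_weight 1) h^-1 N 0) <= h%:E)%E.
  have := @exceeds_from0 R 1 0 (add_weight 1) N N h^-1 ler01 (lexx 0) aw0 maw (add_weight_balance ler01) h1.
  by rewrite /add_weight mulr0 expR0 div1r invrK.
have [B mB [PB HB]] := @sup_bound_event 1 0 (add_weight 1) h^-1 h 0 ler01 (lexx 0) aw0 bound.
exists B => //; split => // w nB; exists h^-1 => j n.
have := HB w nB j n (leq0n j); rewrite tree_fold_leaf_sum leaf_sum1 /add_weight.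
have -> : ((1 - 2 * 1) * j%:R : R) = - j%:R by ring.
by rewrite expRN mulrC ler_pdivrMr ?expR_gt0.
Qed.

(** With [l = 4 / h], the martingale [(1 + l e^{-t})^{-N_t}] starts below
    [h / 4], so with probability at least [1 - h] it stays below 1/4 at all integer
    times; this forces [l e^{-t} N_t >= 1]. *)
Lemma ae_leaf_count_lower : {ae P, forall w, positive (sample w) -> exists2 K : R, 0 < K & forall j n,
  unborn n (sample w) j%:R -> K * expR j%:R <= (size (leaf_seq n (sample w) j%:R))%:R}.
Proof.
apply: ae_of_small => h h0.
pose l : R := 4 / h.
have l0 : 0 < l by rewrite divr_gt0.
have mw0 u : 0 <= mul_weight l u by rewrite invr_ge0 ltW// mul_weight_gt0// ltW.
have mmw : measurable_fun setT (mul_weight l).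
  by apply: continuous_measurable_fun; apply: continuous_mul_weight; exact: ltW.
have q0 : 0 < (4^-1 : R) by [].
have bound N : (clocks_law R N (exceeds 0 1 (mul_weight l) 4^-1 N 0) <= h%:E)%E.
  have := @exceeds_from0 R 0 1 (mul_weight l) N N 4^-1 (lexx 0) ler01 mw0 mmw (mul_weight_balance (ltW l0)) q0.
  move=> /le_trans; apply; rewrite lee_fin /mul_weight oppr0 expR0 mulr1 invrK.
  rewrite mulrC ler_pdivrMr; last lra.
  have -> : h * (1 + l) = h + 4 by rewrite /l; field; rewrite gt_eqF.
  lra.
have [B mB [PB HB]] := @sup_bound_event 0 1 (mul_weight l) 4^-1 h 0 (lexx 0) ler01 mw0 bound.
exists B => //; split => // w nB _; exists l^-1; first by rewrite invr_gt0.
move=> j n Hn; have := HB w nB j n (leq0n j).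
rewrite tree_fold_leaf_count//; set N := size _.
rewrite /mul_weight exprVn.
have p0 : 0 < 1 + l * expR (- j%:R) by exact/mul_weight_gt0/ltW.
rewrite lef_pV2 ?posrE ?exprn_gt0// => H4.
have : 4 <= expR (l * expR (- j%:R) * N%:R).
  apply: (le_trans H4); rewrite expRM_natr; apply: lerXn2r; rewrite ?nnegrE ?expR_ge0//; first exact: ltW.
  exact: expR_ge1Dx.
move=> H.
have : 1 <= l * expR (- j%:R) * N%:R.
  rewrite leNgt; apply/negP => H1.
  have : expR (l * expR (- j%:R) * N%:R) < expR 1 by rewrite ltr_expR.
  have e2 : expR (1 : R) <= 4.
    have -> : (1 : R) = 2^-1 + 2^-1 by field.
    rewrite expRD; have := @expR_le_quadratic R 2^-1 (lexx _) => e3.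
    have e30 := expR_ge0 (2^-1 : R).
    have := ler_pM e30 e30 e3 e3; lra.
  lra.
rewrite expRN; rewrite mulrAC -mulrA -ler_pdivrMl//= mulr1 => H2.
by move: H2; rewrite ler_pdivlMr ?expR_gt0.
Qed.
End almost_sure_facts.

(** * Critical interval, normalizing constants and order statistics *)

Section deterministic_estimates.
Variable R : realType.
Implicit Types (s t z x y : R).

(** Formulated for functions that need only be finite and nonnegative near the
    limit, as is the case for the sums over the leaves. *)
Lemma nonneg_cvge0 {T} (F : set_system T) {FF : Filter F} (f : T -> \bar R) :
  (forall eps : R, 0 < eps -> \forall t \near F, (0 <= f t)%E /\ (f t <= eps%:E)%E) ->
  f @ F --> 0%E.
Proof.
move=> H; apply/fine_cvgP; split.
  near=> t; have [f0 f1] : (0 <= f t)%E /\ (f t <= 1%:E)%E by near: t; apply: H.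
  by rewrite fin_real// (lt_le_trans _ f0)// (le_lt_trans f1)// ltry.
apply/cvgrPdist_le => eps /H; apply: filterS => t.
rewrite /=; case: (f t) => [r| |]/=; last 2 first.
- by case.
- by case.
by rewrite !lee_fin => -[r0 r1]; rewrite sub0r normrN ger0_norm.
Unshelve. all: by end_near. Qed.

(** Convexity of [eta2]: its graph is above its tangents. *)
Lemma eta2_tangent x y : 0 < x -> 0 < y -> eta2 x + ln (x / 2) * (y - x) <= eta2 y.
Proof.
move=> x0 y0; rewrite /eta2 !lnM ?posrE// ?invr_gt0//.
have : ln (x / y) <= x / y - 1.
  have h : -1 < x / y - 1 by rewrite ltrBDl addrN divr_gt0.
  by rewrite -[X in ln X](subrK 1) addrC; exact: le_ln1Dx.
rewrite ln_div ?posrE// -(ler_pM2l y0) !mulrBr mulr1 [y * (x / y)]mulrC divfK ?gt_eqF//.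
lra.
Qed.

(** The tangents at the two solutions of [eta2 x = 1] have slopes of
    opposite signs, so [eta2 >= 1] on the left of [c'] and on the right of [c].  The
    case [c' = 0] is excluded by [eta2 0 = 2]. *)
Lemma outside_critical_interval c' c z : 0 <= c' -> c' < c ->
  eta2 c' = 1 -> eta2 c = 1 -> 0 < z -> ~ (c' / 2 < z < c / 2) ->
  2 * z - 1 <= 2 * z * ln z.
Proof.
move=> c'0 c'c e' ec z0 Hz.
have c'p : 0 < c'.
  rewrite lt_neqAle c'0 andbT; apply/eqP => c'E; move: e'.
  by rewrite /eta2 -c'E mul0r; lra.
have cp := lt_trans c'p c'c.
have zp : 0 < 2 * z by rewrite mulr_gt0.
have l' : ln (c' / 2) <= 0.
  have := eta2_tangent c'p cp; rewrite e' ec -subr_ge0 opprD addNKr oppr_ge0.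
  by rewrite pmulr_lle0// subr_gt0.
have lc : 0 <= ln (c / 2).
  have := eta2_tangent cp c'p; rewrite e' ec -subr_ge0 opprD addNKr oppr_ge0.
  by rewrite nmulr_lle0// subr_lt0.
have : 1 <= eta2 (2 * z).
  have [zc'|c'z] := leP z (c' / 2).
    have := eta2_tangent c'p zp; rewrite e'; apply: le_trans.
    by rewrite lerDl mulr_le0//; lra.
  have [zc|cz] := ltP z (c / 2); first by case: Hz; rewrite c'z zc.
  have := eta2_tangent cp zp; rewrite ec; apply: le_trans.
  by rewrite lerDl mulr_ge0//; lra.
have -> : eta2 (2 * z) = 2 * z * ln z - 2 * z + 2.
  by rewrite /eta2 [2 * z / 2]mulrAC divff// mul1r.
lra.
Qed.

(** This is [e^y <= 1 / (1 - y)] at [y = s / (m + 1 + s)]. *)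
Lemma expR_div_le s (m : nat) : -1 < s -> expR (s / (m.+1%:R + s)) <= (m.+1%:R + s) / m.+1%:R.
Proof.
move=> s1; have m1 : 1 <= m.+1%:R :> R by rewrite ler1n.
have p : 0 < m.+1%:R + s by lra.
rewrite -[leRHS]invf_div -[X in expR X]opprK expRN.
rewrite lef_pV2 ?posrE ?expR_gt0 ?divr_gt0//.
apply: le_trans (expR_ge1Dx _).
by rewrite ler_pdivrMr// mulrBl mul1r divfK ?gt_eqF// addrK.
Qed.

Lemma C_recr n z : C n.+1 z = C n z * ((n%:R + 2 * z) / n.+1%:R).
Proof. by rewrite /C big_ord_recr. Qed.

Lemma C_gt0 n z : 0 < z -> 0 < C n z.
Proof.
move=> z0; apply: prodr_gt0 => k _; rewrite divr_gt0// ltr_wpDl//.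
by rewrite mulr_gt0.
Qed.

Lemma C_factor n z : (n%:R + 2 * z) / n.+1%:R = (n.+1%:R + (2 * z - 1)) / n.+1%:R.
Proof. by rewrite -addn1 natrD; congr (_ / _); ring. Qed.

(** Each factor of [C n z] is [1 + s / (k + 1)] with [s = 2 z - 1].  It is at least
    [e^{s / (k + 1 + s)}], an exponent to be compared with an increment of [s ln]
    over an interval of length 1: to the right of [k + 1 + s] if [s >= 0], to its
    left if [s < 0]. *)
Lemma C_lower z : 0 < z -> exists2 a : R, 0 < a &
  forall n, a * expR ((2 * z - 1) * ln n.+1%:R) <= C n z.
Proof.
move=> z0; set s := 2 * z - 1; have s1 : -1 < s by rewrite /s; lra.
have p n : 0 < n.+1%:R + s.
  have : 1 <= n.+1%:R :> R by rewrite ler1n.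
  lra.
have step n x y : x <= y + s / (n.+1%:R + s) -> expR y <= C n z -> expR x <= C n.+1 z.
  move=> xy yC; apply: (@le_trans _ _ (expR (y + s / (n.+1%:R + s)))).
    by rewrite ler_expR.
  rewrite expRD C_recr C_factor -/s.
  by apply: ler_pM; rewrite ?expR_ge0//; exact: expR_div_le.
have [s0|s0] := leP 0 s.
  exists (expR (- (s * ln (1 + s)))); first exact: expR_gt0.
  move=> n; rewrite -expRD.
  apply: (@le_trans _ _ (expR (s * (ln (n.+1%:R + s) - ln (1 + s))))).
    rewrite ler_expR mulrBr addrC lerD2r; apply: ler_wpM2l => //.
    by rewrite ler_ln ?posrE ?ltr0n// lerDl.
  elim: n => [|n IH]; first by rewrite subrr mulr0 expR0 /C big_ord0.
  apply: (step n) IH; rewrite -lerBlDl -mulrBr; apply: ler_wpM2l => //.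
  have -> : ln (n.+2%:R + s) - ln (1 + s) - (ln (n.+1%:R + s) - ln (1 + s)) =
    ln (n.+2%:R + s) - ln (n.+1%:R + s) by ring.
  rewrite -ln_div ?posrE//.
  have -> : (n.+2%:R + s) / (n.+1%:R + s) = 1 + (n.+1%:R + s)^-1.
    by rewrite -[n.+2]addn1 natrD addrAC mulrDl divff ?mul1r// gt_eqF.
  by apply: le_ln1Dx; rewrite (lt_trans _ (_ : 0 < _)) ?invr_gt0//; lra.
pose b := ln (1 + s) - s * ln (1 + s).
have H n : expR (b + s * ln (n.+1%:R + s)) <= C n.+1 z.
  elim: n => [|n IH].
    rewrite subrK lnK ?posrE; last exact: (p 0).
    by rewrite C_recr C_factor /C big_ord0 mul1r divr1.
  apply: (step n.+1) IH; rewrite -[leRHS]addrA lerD2l -lerBlDl -mulrBr.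
  apply: ler_wnM2l; first exact: ltW.
  rewrite -ln_div ?posrE// -[leRHS]opprK -lnV ?posrE ?divr_gt0// invf_div lerNr.
  have -> : (n.+1%:R + s) / (n.+2%:R + s) = 1 + - (n.+2%:R + s)^-1.
    have -> : n.+1%:R + s = (n.+2%:R + s) - 1 by rewrite -[n.+2]addn1 natrD; ring.
    by rewrite mulrBl divff ?mul1r// gt_eqF.
  apply: le_ln1Dx; rewrite ltrN2 invf_lt1//.
  by have : 2 <= n.+2%:R :> R; [rewrite ler_nat|lra].
exists (Num.min 1 (expR b)); first by rewrite lt_min ltr01 expR_gt0.
case=> [|n]; first by rewrite ln1 mulr0 expR0 mulr1 /C big_ord0 ge_min lexx.
apply: le_trans (H n); rewrite expRD; apply: ler_pM.
- by rewrite le_min ler01 expR_ge0.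
- exact: expR_ge0.
- by rewrite ge_min lexx orbT.
rewrite ler_expR; apply: ler_wnM2l; first exact: ltW.
rewrite ler_ln ?posrE ?ltr0n// -[n.+2]addn1 natrD lerD2l; lra.
Qed.

(** The [k]-th order statistic, with 0 for [k = 0], described by the counting
    function alone. *)
Lemma kth_smallest (s : seq R) k : uniq s -> (forall x, x \in s -> 0 < x) -> (k <= size s)%N ->
  exists t, [/\ 0 <= t, count (fun x => x <= t) s = k &
    forall t', 0 <= t' -> (k <= count (fun x => (x <= t')%R) s)%N -> t <= t'].
Proof.
move=> us ps ks; pose s' := sort <=%O s.
have ss : sorted <%O s' by rewrite sort_lt_sorted.
have cs a : count a s = count a s' by apply/esym/permP; rewrite perm_sort.
case: k ks => [_|k ks].
  exists 0; split=> //; apply/eqP; rewrite eqn0Ngt -has_count; apply/hasPn => x /ps.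
  by rewrite ltNge.
have ks' : (k < size s')%N by rewrite size_sort.
exists (nth 0 s' k); split.
- by apply/ltW/ps; rewrite -(mem_sort <=%O); exact: mem_nth.
- by rewrite cs; exact: count_le_nth.
- move=> t' _; rewrite cs => kt; rewrite leNgt; apply/negP => tk.
  have := count_lt_nth 0 ss ks'; apply/eqP; rewrite gtn_eqF//.
  by apply: leq_trans kt _; apply: sub_count => x /= /le_lt_trans; apply.
Qed.
End deterministic_estimates.

(** * Convergence along one realization, and conclusion *)

Section pathwise_limits.
Variable R : realType.
Variables (e : word -> R).
Hypothesis pe : positive e.
Hypothesis ub : forall K : nat, exists n, unborn n e K%:R.

Lemma leaf_sum_indep (x t : R) n n' : 0 <= x -> 0 <= t -> unborn n e t -> unborn n' e t ->
  leaf_sum x n e t = leaf_sum x n' e t.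
Proof.
move=> x0 t0 un un'; have := esum_leaves x0 pe t0 un.
by rewrite (esum_leaves x0 pe t0 un') => -[].
Qed.

(** Gives one depth that bounds the tree at the real time and at the two
    integer times around it. *)
Lemma integer_bracket (t : R) : 0 <= t -> exists j n : nat,
  [/\ j%:R <= t, t < j.+1%:R, unborn n e j%:R, unborn n e t & unborn n e j.+1%:R].
Proof.
move=> t0; pose j := Num.truncn t; have [n un] := ub j.+1.
have /andP[jt tj] := truncn_itv t0.
by exists j, n; split=> //; apply: (unborn_le _ un); rewrite ?ler_nat// ltW.
Qed.

(** Between two integer times the sum [\sum_u z^|u|] is monotone and the weight
    changes by a bounded factor, so the bound at one of the two endpoints
    suffices: the right one if [z >= 1/2], the left one otherwise. *)
Lemma additive_small (z eps : R) : 0 < z ->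
  (forall i : nat, exists m, forall j n, (m <= j)%N ->
     add_weight z j%:R * leaf_sum z n e j%:R <= i.+1%:R^-1) -> 0 < eps ->
  exists2 T : R, 0 <= T & forall t n, T <= t -> unborn n e t ->
    add_weight z t * leaf_sum z n e t <= eps.
Proof.
move=> z0 av eps0; pose b := expR `|1 - 2 * z|; have b0 : 0 < b by exact: expR_gt0.
have [m Hm] := av (Num.truncn (b / eps)).
have small : b * (Num.truncn (b / eps)).+1%:R^-1 <= eps.
  rewrite ler_pdivrMr ?ltr0n// mulrC -ler_pdivrMr// ltW//; exact: truncnS_gt.
exists m%:R => // t n mt un; have t0 : 0 <= t by exact: le_trans mt.
have [j [n' [jt tj unj unt unj1]]] := integer_bracket t0.
have mj : (m <= j)%N by rewrite -ltnS -(ltr_nat R); exact: le_lt_trans tj.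
rewrite (leaf_sum_indep (ltW z0) t0 un unt).
have weight u : `|t - u| <= 1 -> add_weight z t <= b * add_weight z u.
  move=> tu; rewrite /b /add_weight -expRD ler_expR -lerBlDr -mulrBr.
  apply: le_trans (ler_norm _) _; rewrite normrM ler_piMr//.
have finish i : (m <= i)%N -> `|t - i%:R| <= 1 -> leaf_sum z n' e t <= leaf_sum z n' e i%:R ->
    add_weight z t * leaf_sum z n' e t <= eps.
  move=> mi ti lti; apply: le_trans small.
  apply: (@le_trans _ _ (b * add_weight z i%:R * leaf_sum z n' e i%:R)).
    by apply: ler_pM; rewrite ?expR_ge0 ?leaf_sum_ge0 ?(ltW z0)//; exact: weight.
  by rewrite -mulrA; apply: ler_wpM2l; [exact: ltW|exact: Hm].
have tj' := ltW tj.
have [z2|z2] := leP 2^-1 z.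
  apply: (finish j.+1); first exact: leqW.
    by rewrite ler_norml; move: jt tj; rewrite -natr1; lra.
  exact: leaf_sum_nondecreasing.
apply: (finish j) => //.
  by rewrite ler_norml; move: jt tj; rewrite -natr1; lra.
by apply: leaf_sum_nonincreasing => //; exact: ltW.
Qed.

Lemma yule_martingaleE (t z : R) n : 0 <= z -> 0 <= t -> unborn n e t ->
  yule_martingale e t z = (add_weight z t * leaf_sum z n e t)%:E.
Proof.
move=> z0 t0 un; rewrite /yule_martingale (leaves_leaf_seq pe t0 un).
rewrite (esum_fset (finite_seq _)); last first.
  by move=> u _; rewrite lee_fin mulr_ge0 ?exprn_ge0 ?expR_ge0.
rewrite -fsbig_seq ?leaf_seq_uniq// sumEFin /leaf_sum mulr_sumr /add_weight.
by congr _%:E; apply: eq_bigr => u _; rewrite mulrC (mulrC t).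
Qed.

Lemma yule_martingale_vanish (z : R) : 0 < z ->
  (forall i : nat, exists m, forall j n, (m <= j)%N ->
     add_weight z j%:R * leaf_sum z n e j%:R <= i.+1%:R^-1) ->
  yule_martingale e t z @[t --> +oo] --> 0%E.
Proof.
move=> z0 av; apply: nonneg_cvge0 => eps eps0.
have [T T0 HT] := additive_small z0 av eps0.
exists T; split; first exact: num_real.
move=> t Tt; have t0 : 0 <= t by rewrite (le_trans T0)// ltW.
have [_ [n [_ _ _ un _]]] := integer_bracket t0.
rewrite (yule_martingaleE (ltW z0) t0 un) !lee_fin; split; last by apply: HT => //; exact: ltW.
by rewrite mulr_ge0 ?expR_ge0 ?leaf_sum_ge0// ltW.
Qed.

Section growth.
Variables (k0 K0 : R).
Hypothesis k0p : 0 < k0.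
Hypothesis lo : forall j n, unborn n e j%:R -> k0 * expR j%:R <= (size (leaf_seq n e j%:R))%:R.
Hypothesis up : forall j n, (size (leaf_seq n e j%:R))%:R <= K0 * expR j%:R.

Lemma leaf_count_growth (t : R) n : 0 <= t -> unborn n e t ->
  k0 * expR (- 1) * expR t <= (size (leaf_seq n e t))%:R <= K0 * expR 1 * expR t.
Proof.
move=> t0 un; have [j [n' [jt tj unj unt unj1]]] := integer_bracket t0.
have h : 2^-1 <= 1 :> R by lra.
have tj' := ltW tj.
have j1 : j.+1%:R = j%:R + 1 :> R by rewrite natr1.
rewrite -!leaf_sum1 (leaf_sum_indep ler01 t0 un unt); apply/andP; split.
  apply: (@le_trans _ _ (leaf_sum 1 n' e j%:R)); last exact: leaf_sum_nondecreasing.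
  rewrite leaf_sum1; apply: le_trans (lo unj); rewrite -mulrA -expRD; apply: ler_wpM2l.
    exact: ltW.
  by rewrite ler_expR; lra.
apply: (@le_trans _ _ (leaf_sum 1 n' e j.+1%:R)); first exact: leaf_sum_nondecreasing.
rewrite leaf_sum1; apply: le_trans (up _ _) _.
have K0p : 0 <= K0.
  have [m um] := ub 0; have := up 0 m; rewrite expR0 mulr1; exact: le_trans.
rewrite -mulrA -expRD; apply: ler_wpM2l => //.
by rewrite ler_expR; lra.
Qed.

Hypothesis ds : forall p : word * word, p.1 != p.2 -> splitting_time e p.1 != splitting_time e p.2.

(** The number of leaves is a counting function of distinct positive times, so
    it takes the value [k + 1], and the times at which it does have a least
    element. *)
Lemma tau_spec k : 0 <= tau e k /\
  forall n, unborn n e (tau e k) -> size (leaf_seq n e (tau e k)) = k.+1.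
Proof.
have [T T0 HT] : exists2 T : nat, True & forall n, unborn n e T%:R -> (k < size (leaf_seq n e T%:R))%N.
  pose T := (Num.truncn (k.+1%:R / k0)).+1; exists T => // n un.
  rewrite -(ler_nat R); apply: le_trans (lo un).
  rewrite mulrC -ler_pdivrMr//; apply: le_trans (_ : T%:R <= _).
    by rewrite ltW// truncnS_gt.
  by apply: le_trans (expR_ge1Dx _); rewrite lerDr.
have [n un] := ub T.
pose s := map (splitting_time e) (short_words n).
have us : uniq s.
  rewrite map_inj_uniq ?short_words_uniq// => u v uv; apply/eqP; apply: contraT => nuv.
  by have := ds (p := (u, v)) nuv; rewrite /= uv eqxx.
have sz t : 0 <= t -> unborn n e t -> size (leaf_seq n e t) = (count (fun x => x <= t) s).+1.
  by move=> t0 ut; rewrite size_leaf_seq// count_map.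
have kT : (k <= count (fun x => (x <= T%:R)%R) s)%N by rewrite -ltnS -sz//; exact: HT.
have ks : (k <= size s)%N by apply: leq_trans kT _; exact: count_size.
have ps x : x \in s -> 0 < x by move=> /mapP[u _ ->]; exact: splitting_gt0.
have [t [t0 ct mt]] := kth_smallest us ps ks.
have tT : t <= T%:R by exact: mt.
have unt := unborn_le tT un.
have tA : 0 <= t /\ (leaves (yule_tree e t) #= `I_k.+1)%card.
  by split=> //; apply/(card_leaves _ pe t0 unt); rewrite sz// ct.
have lbA : lbound [set t | 0 <= t /\ (leaves (yule_tree e t) #= `I_k.+1)%card] t.
  move=> t' [t'0]; have [t'T|/ltW Tt' _] := leP t' T%:R; last exact: le_trans Tt'.
  have unt' := unborn_le t'T un.
  move=> /(card_leaves _ pe t'0 unt'); rewrite sz// => -[ck].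
  by apply: mt => //; rewrite ck.
have -> : tau e k = t.
  apply/eqP; rewrite eq_le; apply/andP; split.
    by apply: ge_inf => //; exists t.
  by apply: lb_le_inf => //; exists t.
split=> // n' un'; have := leaf_sum_indep ler01 t0 un' unt.
rewrite !leaf_sum1 => /eqP; rewrite eqr_nat => /eqP ->.
by rewrite sz// ct.
Qed.

(** At time [tau e k] there are [k + 1] leaves, and the number of leaves at time
    [t] is of order [e^t]. *)
Lemma tau_ln : exists D : R, forall k, `|tau e k - ln k.+1%:R| <= D.
Proof.
have K0p : 0 < K0.
  have [n un] := ub 0; have := up 0 n; rewrite expR0 mulr1; apply: lt_le_trans.
  by have := lo un; rewrite expR0 mulr1; exact: lt_le_trans.
pose a := k0 * expR (- 1); pose b := K0 * expR 1.
have ap : 0 < a by rewrite mulr_gt0 ?expR_gt0.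
have bp : 0 < b by rewrite mulr_gt0 ?expR_gt0.
exists (`|ln a| + `|ln b|) => k.
have [t0 sk] := tau_spec k; have [_ [n [_ _ _ un _]]] := integer_bracket t0.
have := leaf_count_growth t0 un; rewrite (sk _ un) -/a -/b => /andP[h1 h2].
have k1 : 0 < k.+1%:R :> R by [].
have : ln a + tau e k <= ln k.+1%:R.
  by rewrite -[X in _ + X]expRK -lnM ?posrE ?expR_gt0// ler_ln ?posrE ?mulr_gt0 ?expR_gt0.
have : ln k.+1%:R <= ln b + tau e k.
  by rewrite -[X in _ + X]expRK -lnM ?posrE ?expR_gt0// ler_ln ?posrE ?mulr_gt0 ?expR_gt0.
have := ler_norm (- ln a); have := ler_norm (ln b); rewrite normrN.
have := normr_ge0 (ln a); have := normr_ge0 (ln b).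
rewrite ler_norml; lra.
Qed.

Lemma tau_large (T : R) : exists m, forall k, (m <= k)%N -> T <= tau e k.
Proof.
have [D HD] := tau_ln.
exists (Num.truncn (expR (T + D))).+1 => k mk.
have := HD k; rewrite ler_norml => /andP[h _].
suff : T + D <= ln k.+1%:R by lra.
rewrite -[leLHS]expRK ler_ln ?posrE ?expR_gt0 ?ltr0n//.
apply: (le_trans (ltW (truncnS_gt _))); rewrite ler_nat; exact: leqW.
Qed.

(** The ratio of the two normalizations is bounded, by the estimates on
    [C n z] and on [tau e n - ln (n + 1)]. *)
Lemma bst_martingale_vanish (z : R) : 0 < z ->
  (forall i : nat, exists m, forall j n, (m <= j)%N ->
     add_weight z j%:R * leaf_sum z n e j%:R <= i.+1%:R^-1) ->
  bst_martingale e n z @[n --> \oo] --> 0%E.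
Proof.
move=> z0 av; apply: nonneg_cvge0 => eps eps0.
have [D HD] := tau_ln.
have [a a0 Ha] := C_lower z0.
set s := 2 * z - 1 in Ha.
pose B := expR (`|s| * D) / a.
have B0 : 0 < B by rewrite divr_gt0 ?expR_gt0.
have [T T0 HT] := additive_small z0 av (divr_gt0 eps0 B0).
have [m Hm] := tau_large T.
exists m => // k /= mk.
have [t0 _] := tau_spec k; have [_ [n [_ _ _ un _]]] := integer_bracket t0.
rewrite /bst_martingale /bst (esum_leaves (ltW z0) pe t0 un) -EFinM !lee_fin.
have Cp := C_gt0 k z0.
have lp := leaf_sum_ge0 n e (tau e k) (ltW z0).
split; first by rewrite mulr_ge0// invr_ge0 ltW.
have := HT _ _ (Hm _ mk) un; rewrite ler_pdivlMr// => H; apply: le_trans H.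
rewrite mulrAC; apply: ler_wpM2r => //.
rewrite -[leLHS]mul1r ler_pdivrMr//.
apply: (@le_trans _ _ (add_weight z (tau e k) * B * (a * expR (s * ln k.+1%:R)))); last first.
  by apply: ler_wpM2l => //; rewrite mulr_ge0 ?expR_ge0// ltW.
have -> : add_weight z (tau e k) * B * (a * expR (s * ln k.+1%:R)) =
    expR (`|s| * D + s * (ln k.+1%:R - tau e k)).
  rewrite /add_weight /B expRD mulrBr expRD.
  have -> : (1 - 2 * z) * tau e k = - (s * tau e k) by rewrite /s; ring.
  by field; rewrite gt_eqF.
rewrite -[leLHS]expR0 ler_expR -[leLHS](subrr (`|s| * D)) lerD2l lerNl.
apply: le_trans (ler_norm _) _; rewrite normrN normrM (distrC (ln _)).
exact: ler_wpM2l.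
Qed.
End growth.

End pathwise_limits.

Theorem theorem3p4 (R : realType) (d : measure_display)
    (Omega : measurableType d) (P : probability Omega R)
    (clock : word -> {RV P >-> R}) (c' c : R)
    (Hclock : iid_exponential1_clocks clock)
    (Hc'0 : 0 <= c') (Hc'c : c' < c)
    (Hc' : eta2 c' = 1) (Hc : eta2 c = 1)
    (z : R) (Hz0 : 0 < z) (Hz : ~ (c' / 2 < z < c / 2)) :
  {ae P, forall w : Omega,
    (yule_martingale (fun u => clock u w) t z @[t --> +oo] --> 0%E) /\
    (bst_martingale (fun u => clock u w) n z @[n --> \oo] --> 0%E)}.
Proof.
have zc := outside_critical_interval Hc'0 Hc'c Hc' Hc Hz0 Hz.
have FF : Filter (nbhs (almost_everywhere P)) by exact: _.
have A1 := @filterI _ _ FF _ _ (ae_positive Hclock) (@filterI _ _ FF _ _ (ae_unborn Hclock) (ae_distinct_splits Hclock)).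
have A2 := @filterI _ _ FF _ _ (ae_leaf_count_upper Hclock) (ae_leaf_count_lower Hclock).
have A := @filterI _ _ FF _ _ (@filterI _ _ FF _ _ A1 A2) (ae_additive_vanish Hclock Hz0 zc).
apply: filterS A => w [[[pe [ub ds]] [[K0 up] lo]] av].
have {}ub := ub pe; have [k0 k0p {}lo] := lo pe.
split; first exact: (yule_martingale_vanish pe ub Hz0 av).
exact: (bst_martingale_vanish pe ub k0p lo up ds Hz0 av).
Qed.
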